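(* Let $(M,g)$ be a Riemannian manifold and let $T^1_1(M)$ be its $(1,1)$-tensor bundle with the rescaled Sasaki type metric ${}^Sg_f$. Then $(T^1_1(M),{}^Sg_f)$ is locally flat if and only if $M$ is locally flat and $$\nabla_m\Big(\tfrac1{2f}{}^fA_{lj}^r\Big)-\nabla_l\Big(\tfrac1{2f}{}^fA_{mj}^r\Big)+\tfrac1{4f^2}{}^fA_{ms}^r\,{}^fA_{lj}^s-\tfrac1{4f^2}{}^fA_{ls}^r\,{}^fA_{mj}^s=0 .$$
   Context: All objects are smooth; Einstein summation. $f>0$ is a smooth function on $M$. $\nabla$ is the Levi-Civita connection of $g$ with Christoffel symbols $\Gamma_{ij}^h$. The $(1,2)$-tensor field ${}^fA$ is ${}^fA_{ji}^h=f_j\delta_i^h+f_i\delta_j^h-f^hg_{ji}$ with $f_i=\partial_if$, $f^h=g^{hm}f_m$. $T^1_1(M)$ is the bundle of $(1,1)$-tensors, with induced local coordinates $(x^j,t_j^i)$, a point being $t=t_j^i\,\partial_i\otimes dx^j$ at $x$. The vertical lift of a $(1,1)$-tensor field $A$ is ${}^VA=A_j^i\,\partial/\partial t_j^i$; the horizontal lift of a vector field $X$ is ${}^HX=X^j\partial/\partial x^j+X^s(\Gamma_{sj}^mt_m^i-\Gamma_{sm}^it_j^m)\,\partial/\partial t_j^i$. The metric is ${}^Sg_f({}^VA,{}^VB)=g_{ic}g^{jl}A_j^iB_l^c$, ${}^Sg_f({}^VA,{}^HY)=0$, ${}^Sg_f({}^HX,{}^HY)=f\,g(X,Y)$. ''Locally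 flat'' means that the Riemannian curvature tensor vanishes. *)

(* Defs.v *)
From HB Require Import structures.
From mathcomp Require Import all_boot all_order all_algebra.
From mathcomp Require Import all_classical all_reals all_analysis.

Set Implicit Arguments.
Unset Strict Implicit.
Unset Printing Implicit Defensive.

Import Order.TTheory GRing.Theory Num.Theory.
Import numFieldNormedType.Exports.

Local Open Scope classical_set_scope.
Local Open Scope ring_scope.

(** A point of R^N is a row vector.
    In the arguments of component functions the lower indices come first and
    the upper index last, in the order in which they are printed: the term
    [christoffel g x i j h] is Gamma_{ij}^h at x.  The matrix t of a
    (1,1)-tensor has entries t i j = t_j^i (upper index = row). *)

Section Coordinates.
Variables (R : realType) (N : nat).

Definition partial (k : 'I_N) (F : 'rV[R]_N -> R) (x : 'rV[R]_N) : R :=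
  'D_(delta_mx 0 k) F x.

(** C^oo on the open set V: the iterated partial derivatives of all orders,
    F itself included, are (Frechet) differentiable at every point of V. *)
Definition smooth_on (V : set 'rV[R]_N) (F : 'rV[R]_N -> R) : Prop :=
  forall (s : seq 'I_N) (x : 'rV[R]_N), V x ->
    differentiable (foldr partial F s) x.

Variable g : 'rV[R]_N -> 'M[R]_N.

Definition christoffel (x : 'rV[R]_N) (i j h : 'I_N) : R :=
  2^-1 * \sum_(m < N) invmx (g x) h m *
    (partial i (fun y => g y m j) x + partial j (fun y => g y i m) x
     - partial m (fun y => g y i j) x).

(** R_{mlj}^r *)
Definition riemann (x : 'rV[R]_N) (m l j r : 'I_N) : R :=
  partial m (fun y => christoffel y l j r) x
  - partial l (fun y => christoffel y m j r) x
  + \sum_(s < N) (christoffel x m s r * christoffel x l j s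
                  - christoffel x l s r * christoffel x m j s).

(** nabla_m T_{lj}^r for a (1,2)-tensor field T *)
Definition nabla12 (T : 'rV[R]_N -> 'I_N -> 'I_N -> 'I_N -> R)
    (x : 'rV[R]_N) (m l j r : 'I_N) : R :=
  partial m (fun y => T y l j r) x
  + \sum_(s < N) (christoffel x m s r * T x l j s
                  - christoffel x m l s * T x s j r
                  - christoffel x m j s * T x l s r).

(** ^fA_{ji}^h, for the coordinate expression F of f *)
Definition fA (F : 'rV[R]_N -> R) (x : 'rV[R]_N) (j i h : 'I_N) : R :=
  partial j F x * (i == h)%:R + partial i F x * (j == h)%:R
  - (\sum_(m < N) invmx (g x) h m * partial m F x) * g x j i.

End Coordinates.

(** Points with local coordinates around each of them; a metric is given by its
    components in every coordinate system, as functions of the coordinates. *)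
Record coordinateSystems (R : realType) (N : nat) := CoordinateSystems {
  cs_point : Type;
  cs_index : Type;
  cs_dom : cs_index -> set cs_point;
  cs_coord : cs_index -> cs_point -> 'rV[R]_N
}.

Definition metricComponents (R : realType) (N : nat)
    (X : coordinateSystems R N) : Type :=
  cs_index X -> 'rV[R]_N -> 'M[R]_N.

(** The Riemannian curvature tensor vanishes at every point. *)
Definition locally_flat (R : realType) (N : nat) (X : coordinateSystems R N)
    (G : metricComponents X) : Prop :=
  forall (a : cs_index X) (p : cs_point X), cs_dom a p ->
  forall m l j r : 'I_N, riemann (G a) (cs_coord a p) m l j r = 0.

Section Manifolds.
Variables (R : realType) (n : nat).

(** The atlas need not be maximal.  [chart_inv a] is only meaningful on the
    open set [chart a @` chart_dom a]. *)
Record smoothManifold := SmoothManifold {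
  mfd_space :> topologicalType;
  mfd_hausdorff : hausdorff_space mfd_space;
  mfd_second_countable : @second_countable mfd_space;
  chart_index : Type;
  chart_dom : chart_index -> set mfd_space;
  chart : chart_index -> mfd_space -> 'rV[R]_n;
  chart_inv : chart_index -> 'rV[R]_n -> mfd_space;
  chart_cover : forall p : mfd_space, exists a, chart_dom a p;
  chart_dom_open : forall a, open (chart_dom a);
  chart_image_open : forall a, open (chart a @` chart_dom a);
  chartK : forall a p, chart_dom a p -> chart_inv a (chart a p) = p;
  chart_continuous : forall a, {within chart_dom a, continuous (chart a)};
  chart_inv_continuous : forall a,
    {within chart a @` chart_dom a, continuous (chart_inv a)};
  transition_smooth : forall a b (i : 'I_n),
    smooth_on (chart a @` (chart_dom a `&` chart_dom b))
              (fun x => chart b (chart_inv a x) 0 i)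
}.

Definition manifold_coordinates (M : smoothManifold) : coordinateSystems R n :=
  CoordinateSystems (@chart_dom M) (@chart M).

Definition smooth_function (M : smoothManifold) (f : M -> R) : Prop :=
  forall a : chart_index M,
    smooth_on (chart a @` chart_dom a) (fun x => f (chart_inv a x)).

(** The entry (i, k) is dy^i/dx^k at p, where x are the coordinates of the
    chart a and y those of the chart b. *)
Definition transition_jacobian (M : smoothManifold) (a b : chart_index M)
    (p : M) : 'M[R]_n :=
  \matrix_(i, k) partial k (fun x => chart b (chart_inv a x) 0 i) (chart a p).

Record riemannianMetric (M : smoothManifold) := RiemannianMetric {
  metric_comp :> metricComponents (manifold_coordinates M);
  metric_smooth : forall (a : chart_index M) (i j : 'I_n),
    smooth_on (chart a @` chart_dom a) (fun x => metric_comp a x i j);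
  metric_sym : forall (a : chart_index M) (p : M), chart_dom a p ->
    (metric_comp a (chart a p))^T = metric_comp a (chart a p);
  metric_posdef : forall (a : chart_index M) (p : M), chart_dom a p ->
    forall v : 'rV[R]_n, v != 0 ->
      0 < (v *m metric_comp a (chart a p) *m v^T) 0 0;
  metric_transform : forall (a b : chart_index M) (p : M),
    chart_dom a p -> chart_dom b p ->
    metric_comp a (chart a p) =
      (transition_jacobian a b p)^T *m metric_comp b (chart b p)
        *m transition_jacobian a b p
}.

(** A (1,1)-tensor at p: its component matrices in the charts around p, related
    by the transformation law.  The value at the other charts is normalized to
    0, so that distinct terms are distinct tensors. *)
Record tensor11 (M : smoothManifold) (p : M) := Tensor11 {
  tensor_comp :> chart_index M -> 'M[R]_n;
  tensor_junk : forall a, ~ chart_dom a p -> tensor_comp a = 0;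
  tensor_transform : forall a b, chart_dom a p -> chart_dom b p ->
    tensor_comp b =
      transition_jacobian a b p *m tensor_comp a *m transition_jacobian b a p
}.

(** The bundle T^1_1(M) with its induced coordinates (x^j, t_j^i); the n * n
    last coordinates are the entries of t, row by row. *)
Definition T11 (M : smoothManifold) : coordinateSystems R (n + n * n) :=
  @CoordinateSystems R (n + n * n) {p : M & tensor11 p} (chart_index M)
    (fun a P => chart_dom a (projT1 P))
    (fun a P => row_mx (chart a (projT1 P)) (mxvec (projT2 P a))).

End Manifolds.

Section Sasaki.
Variables (R : realType) (n : nat).
(* the components of a metric and the expression of f in one chart of M *)
Variables (g : 'rV[R]_n -> 'M[R]_n) (F : 'rV[R]_n -> R).

Definition base_coord (z : 'rV[R]_(n + n * n)) : 'rV[R]_n := lsubmx z.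
Definition fibre_coord (z : 'rV[R]_(n + n * n)) : 'M[R]_n := vec_mx (rsubmx z).

Definition vlift (A : 'M[R]_n) : 'rV[R]_(n + n * n) := row_mx 0 (mxvec A).

Definition hlift_fibre (z : 'rV[R]_(n + n * n)) (X : 'rV[R]_n) : 'M[R]_n :=
  let x := base_coord z in let t := fibre_coord z in
  \matrix_(i, j) \sum_(s < n) X 0 s *
    \sum_(m < n) (christoffel g x s j m * t i m - christoffel g x s m i * t m j).

Definition hlift (z : 'rV[R]_(n + n * n)) (X : 'rV[R]_n) :
    'rV[R]_(n + n * n) :=
  row_mx X (mxvec (hlift_fibre z X)).

(** u = ^H(horizontal_part u) + ^V(vertical_part z u) for u tangent at z *)
Definition horizontal_part (u : 'rV[R]_(n + n * n)) : 'rV[R]_n := lsubmx u.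
Definition vertical_part (z u : 'rV[R]_(n + n * n)) : 'M[R]_n :=
  vec_mx (rsubmx u) - hlift_fibre z (lsubmx u).

Definition base_product (x X Y : 'rV[R]_n) : R :=
  \sum_(i < n) \sum_(j < n) g x i j * X 0 i * Y 0 j.
Definition fibre_product (x : 'rV[R]_n) (A B : 'M[R]_n) : R :=
  \sum_(i < n) \sum_(c < n) \sum_(j < n) \sum_(l < n)
    g x i c * invmx (g x) j l * A i j * B c l.

Definition sasaki_product (z u v : 'rV[R]_(n + n * n)) : R :=
  F (base_coord z)
    * base_product (base_coord z) (horizontal_part u) (horizontal_part v)
  + fibre_product (base_coord z) (vertical_part z u) (vertical_part z v).

Definition sasaki_comp (z : 'rV[R]_(n + n * n)) : 'M[R]_(n + n * n) :=
  \matrix_(a, b) sasaki_product z (delta_mx 0 a) (delta_mx 0 b).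

Lemma lift_decomposition (z u : 'rV[R]_(n + n * n)) :
  u = hlift z (horizontal_part u) + vlift (vertical_part z u).
Proof.
rewrite /hlift /vlift /vertical_part add_row_mx addr0 linearB /= vec_mxK.
by rewrite addrC subrK hsubmxK.
Qed.

Lemma hlift_fibre_linear (z : 'rV[R]_(n + n * n)) : linear (hlift_fibre z).
Proof.
move=> a X Y; apply/matrixP => i j; rewrite !mxE mulr_sumr -big_split /=.
by apply: eq_bigr => s _; rewrite !mxE mulrDl mulrA.
Qed.

Lemma vertical_part_linear (z : 'rV[R]_(n + n * n)) : linear (vertical_part z).
Proof.
move=> a u v; rewrite /vertical_part !linearP /= hlift_fibre_linear.
by rewrite scalerBr opprD addrACA.
Qed.

Lemma base_productPl (x Z : 'rV[R]_n) : scalar (base_product x ^~ Z).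
Proof.
move=> a X Y; rewrite /base_product mulr_sumr -big_split /=.
apply: eq_bigr => i _; rewrite mulr_sumr -big_split /=.
by apply: eq_bigr => j _; rewrite !mxE mulrDr mulrDl; congr (_ + _);
  rewrite !mulrA [a * _]mulrC.
Qed.

Lemma base_productPr (x Z : 'rV[R]_n) : scalar (base_product x Z).
Proof.
move=> a X Y; rewrite /base_product mulr_sumr -big_split /=.
apply: eq_bigr => i _; rewrite mulr_sumr -big_split /=.
by apply: eq_bigr => j _; rewrite !mxE mulrDr mulrCA.
Qed.

Lemma fibre_productPl (x : 'rV[R]_n) (C : 'M[R]_n) :
  scalar (fibre_product x ^~ C).
Proof.
move=> a A B; rewrite /fibre_product.
do 4![rewrite mulr_sumr -big_split /=; apply: eq_bigr => ? _].
by rewrite !mxE mulrDr mulrDl mulrCA !mulrA.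
Qed.

Lemma fibre_productPr (x : 'rV[R]_n) (C : 'M[R]_n) :
  scalar (fibre_product x C).
Proof.
move=> a A B; rewrite /fibre_product.
do 4![rewrite mulr_sumr -big_split /=; apply: eq_bigr => ? _].
by rewrite !mxE mulrDr mulrCA.
Qed.

Lemma sasaki_productPl (z w : 'rV[R]_(n + n * n)) :
  scalar (sasaki_product z ^~ w).
Proof.
move=> a u v; rewrite /sasaki_product /horizontal_part vertical_part_linear.
rewrite linearP base_productPl fibre_productPl !mulrDr addrACA.
by rewrite mulrCA.
Qed.

Lemma sasaki_productPr (z w : 'rV[R]_(n + n * n)) :
  scalar (sasaki_product z w).
Proof.
move=> a u v; rewrite /sasaki_product /horizontal_part vertical_part_linear.
rewrite linearP base_productPr fibre_productPr !mulrDr addrACA.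
by rewrite mulrCA.
Qed.

Lemma sasaki_compE (z u v : 'rV[R]_(n + n * n)) :
  (u *m sasaki_comp z *m v^T) 0 0 = sasaki_product z u v.
Proof.
pose Ll w := GRing.isLinear.Build _ _ _ _ _ (@sasaki_productPl z w).
pose Lr w := GRing.isLinear.Build _ _ _ _ _ (@sasaki_productPr z w).
pose fl w : {scalar 'rV[R]_(n + n * n)} := HB.pack (sasaki_product z ^~ w) (Ll w).
pose fr w : {scalar 'rV[R]_(n + n * n)} := HB.pack (sasaki_product z w) (Lr w).
have El w : sasaki_product z u w
    = \sum_a u 0 a * sasaki_product z (delta_mx 0 a) w.
  rewrite {1}(row_sum_delta u) -[LHS]/(fl w _) linear_sum.
  by apply: eq_bigr => a _; rewrite linearZ.
have Er w : sasaki_product z w v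
    = \sum_b v 0 b * sasaki_product z w (delta_mx 0 b).
  rewrite {1}(row_sum_delta v) -[LHS]/(fr w _) linear_sum.
  by apply: eq_bigr => b _; rewrite linearZ.
rewrite Er mxE; apply: eq_bigr => b _; rewrite El !mxE mulrC; congr (_ * _).
by apply: eq_bigr => a _; rewrite !mxE.
Qed.

Lemma vertical_part_vlift z A : vertical_part z (vlift A) = A.
Proof.
rewrite /vertical_part /vlift row_mxKr row_mxKl mxvecK.
rewrite (_ : hlift_fibre z 0 = 0) ?subr0 //.
by apply/matrixP => i j; rewrite !mxE big1 // => s _; rewrite mxE mul0r.
Qed.

Lemma vertical_part_hlift z X : vertical_part z (hlift z X) = 0.
Proof. by rewrite /vertical_part /hlift row_mxKr row_mxKl mxvecK subrr. Qed.

Lemma sasaki_VV (z : 'rV[R]_(n + n * n)) (A B : 'M[R]_n) :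
  (vlift A *m sasaki_comp z *m (vlift B)^T) 0 0 = fibre_product (base_coord z) A B.
Proof.
rewrite sasaki_compE /sasaki_product !vertical_part_vlift.
rewrite /horizontal_part /vlift !row_mxKl /base_product big1 ?mulr0 ?add0r //.
by move=> i _; rewrite big1 // => j _; rewrite !mxE mulr0.
Qed.

Lemma sasaki_VH (z : 'rV[R]_(n + n * n)) (A : 'M[R]_n) (Y : 'rV[R]_n) :
  (vlift A *m sasaki_comp z *m (hlift z Y)^T) 0 0 = 0.
Proof.
rewrite sasaki_compE /sasaki_product vertical_part_vlift vertical_part_hlift.
rewrite /horizontal_part /vlift row_mxKl /base_product /fibre_product.
rewrite big1 ?mulr0 ?add0r => [|i _]; last first.
  by rewrite big1 // => j _; rewrite !mxE mulr0 mul0r.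
by do 4![rewrite big1 // => ? _]; rewrite !mxE mulr0.
Qed.

Lemma sasaki_HH (z : 'rV[R]_(n + n * n)) (X Y : 'rV[R]_n) :
  (hlift z X *m sasaki_comp z *m (hlift z Y)^T) 0 0
  = F (base_coord z) * base_product (base_coord z) X Y.
Proof.
rewrite sasaki_compE /sasaki_product !vertical_part_hlift.
rewrite /horizontal_part /hlift !row_mxKl /fibre_product.
rewrite [X in _ + X]big1 ?addr0 // => i _.
by do 3![rewrite big1 // => ? _]; rewrite !mxE mulr0.
Qed.

End Sasaki.

(** ^Sg_f: by [lift_decomposition], [sasaki_VV], [sasaki_VH] and [sasaki_HH],
    the only metric with the prescribed values on lifts. *)
Definition sasaki_metric (R : realType) (n : nat) (M : smoothManifold R n)
    (g : riemannianMetric M) (f : M -> R) : metricComponents (T11 M) :=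
  fun (a : chart_index M) z =>
    sasaki_comp (metric_comp g a) (fun x => f (chart_inv a x)) z.

(* Main.v *)
Require Import Defs.
From HB Require Import structures.
From mathcomp Require Import all_boot all_order all_algebra.
From mathcomp Require Import all_classical all_reals all_analysis.
From mathcomp Require Import ring lra.

Set Implicit Arguments.
Unset Strict Implicit.
Unset Printing Implicit Defensive.

Import Order.TTheory GRing.Theory Num.Theory.
Import numFieldNormedType.Exports.

(** The condition on f says that the conformal metric f g has the same
    curvature as g: the difference of the Levi-Civita connections of f g and g
    is the tensor T = (1/2f) ^fA, and the curvature of a connection changed by T
    changes by nabla T antisymmetrized plus the commutator of T, which is the
    left-hand side of the displayed equation ([riemann_scale]).  So the theorem
    says that the total space is flat if and only if g and f g are flat.

    In a chart, a vector u tangent to the bundle at z has a horizontal part X and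
    a vertical part [vertical_part g z u], a matrix, and the Sasaki metric is
    f g(X, X) + h(vert u, vert u), where h is the metric induced by g on
    matrices.  The connection induced on the fibres by g is the commutator with
    the connection matrix of g; it preserves h, and its curvature is the
    commutator with the curvature of g.  For constant fields u, w put
    C(w, u) = the lift of (nabla^{fg}_w X, nabla_w vert u) ([sasaki_conn]).  This
    connection is metric everywhere ([is_derive_sasaki]), and its torsion at a
    point (x, t) is the commutator of the curvature of g with t
    ([sasaki_conn_sym]).  So C is the Levi-Civita connection at (x, t) whenever
    that commutator vanishes ([sasaki_christoffel]), and where this holds along
    two coordinate lines, the corresponding curvature of the total space is the
    lift of the curvature of f g acting on X and of the commutator of the
    curvature of g with vert u ([sasaki_riemann]).

    If g is flat, this applies everywhere, and the flatness of g and f g gives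
    that of the total space ([sasaki_flat]).  Conversely, it applies along the
    zero section, t = 0, without any hypothesis on g.  If the total space is flat,
    then f g is flat, and the curvature of g commutes with all matrices, so it is
    a scalar matrix; being skew for g, it is zero ([flat_of_sasaki_flat]).

    The formula for the curvature and the skewness rest on the symmetry of second
    derivatives ([derive_comm]). *)

Local Open Scope classical_set_scope.
Local Open Scope ring_scope.

(** * Directional derivatives of matrix-valued functions *)

Section DirectionalDerivative.
Variables (R : realType) (E : normedModType R).
Implicit Types (x v : E).

Lemma is_derive_mxP m n (A : E -> 'M[R]_(m, n)) x v dA :
  is_derive x v A dA <->
  forall i j, is_derive x v (fun y => A y i j) (dA i j).
Proof.
split=> [[Ad <-] i j|Ad].
  rewrite derive_mx// mxE; apply: derivableP.
  by have /derivable_mxP := Ad; apply.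
have Ad' : derivable A x v by apply/derivable_mxP => i j; case: (Ad i j).
split=> //; rewrite derive_mx//; apply/matrixP => i j; rewrite mxE.
by case: (Ad i j).
Qed.

Lemma is_derive_add (W : normedModType R) (A B : E -> W) x v dA dB :
  is_derive x v A dA -> is_derive x v B dB ->
  is_derive x v (fun y => A y + B y) (dA + dB).
Proof. by move=> Ad Bd; exact: is_deriveD. Qed.

Lemma is_derive_sub (W : normedModType R) (A B : E -> W) x v dA dB :
  is_derive x v A dA -> is_derive x v B dB ->
  is_derive x v (fun y => A y - B y) (dA - dB).
Proof. by move=> Ad Bd; exact: is_deriveB. Qed.

Lemma is_derive_const (W : normedModType R) (a : W) x v :
  is_derive x v (fun=> a) 0.
Proof. exact: is_derive_cst. Qed.

Lemma is_derive_mul (F G : E -> R) x v dF dG :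
  is_derive x v F dF -> is_derive x v G dG ->
  is_derive x v (fun y => F y * G y) (dF * G x + F x * dG).
Proof.
move=> Fd Gd; apply: is_derive_eq; rewrite addrC; congr (_ + _).
by rewrite -[LHS]/(_ * _) mulrC.
Qed.

Lemma is_derive_bigsum (W : normedModType R) (I : finType) (F : I -> E -> W)
    x v dF :
  (forall i, is_derive x v (F i) (dF i)) ->
  is_derive x v (fun y => \sum_i F i y) (\sum_i dF i).
Proof.
move=> Fd; rewrite (_ : (fun y => _) = \sum_i F i); last first.
  by apply/funext => y; rewrite fct_sumE.
elim/big_ind2 : _ => [|G dG H dH Gd Hd|i _]; last exact: Fd.
- exact: is_derive_cst.
- exact: is_deriveD.
Qed.

Lemma is_derive_mulmx m n p (A : E -> 'M[R]_(m, n)) (B : E -> 'M[R]_(n, p))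
    x v dA dB :
  is_derive x v A dA -> is_derive x v B dB ->
  is_derive x v (fun y => A y *m B y) (dA *m B x + A x *m dB).
Proof.
move=> /is_derive_mxP Ad /is_derive_mxP Bd; apply/is_derive_mxP => i j.
under eq_fun do rewrite mxE.
rewrite !mxE -big_split/=; apply: is_derive_bigsum => k.
exact: is_derive_mul.
Qed.

Lemma is_derive_trmx m n (A : E -> 'M[R]_(m, n)) x v dA :
  is_derive x v A dA -> is_derive x v (fun y => (A y)^T) dA^T.
Proof.
move=> /is_derive_mxP Ad; apply/is_derive_mxP => i j; rewrite mxE.
by under eq_fun do rewrite mxE.
Qed.

Lemma is_derive_mxtrace n (A : E -> 'M[R]_n) x v dA :
  is_derive x v A dA -> is_derive x v (fun y => \tr (A y)) (\tr dA).
Proof. by move=> /is_derive_mxP Ad; exact: is_derive_bigsum. Qed.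

Lemma is_derive_lineP (W : normedModType R) (F : E -> W) x v d :
  is_derive x v F d <->
  is_derive (0 : R) (1 : R) (fun h : R => F (h *: v + x)) d.
Proof.
have e : 'D_v F x = 'D_(1 : R) (fun h : R => F (h *: v + x)) 0.
  rewrite /derive; set p := fun h => h^-1 *: _; set q := fun h => h^-1 *: _.
  suff -> : p = q by []; apply/funext => h; rewrite /p /q /=.
  by rewrite addr0 scale0r add0r [_%:A]mulr1.
split=> -[Fd <-]; split=> //.
- exact: (derivable1P F x v).1.
- exact: (derivable1P F x v).2.
Qed.
End DirectionalDerivative.

Lemma near_translate (R : realType) (E : normedModType R) (x : E) (P : set E) :
  (\forall y \near x, P y) -> \forall h \near (0 : E), P (h + x).
Proof. by rewrite (near_shift 0) subr0. Qed.

Lemma near_line (R : realType) (E : normedModType R) (x v : E) (P : set E) :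
  (\forall y \near x, P y) -> \forall h \near (0 : R), P (h *: v + x).
Proof. by move=> /near_translate H; exact: (@near0Z _ _ v (fun h => P (h + x))). Qed.

(** A directional derivative at a point only depends on the values along a line,
    so it can be transported between functions on different spaces, such as a
    function of the base point and its pullback to the bundle, or between
    functions that agree on the zero section only. *)
Lemma is_derive_along_line (R : realType) (E E' W : normedModType R)
    (F : E -> W) (G : E' -> W) x v x' v' d :
  (\forall h \near (0 : R), F (h *: v + x) = G (h *: v' + x')) ->
  is_derive x v F d -> is_derive x' v' G d.
Proof.
move=> FG /is_derive_lineP Fd; apply/is_derive_lineP.
exact: near_eq_is_derive Fd.
Qed.

Lemma differentiable_bound (R : realType) (E : normedModType R) (F : E -> R)
    (x : E) e : differentiable F x -> 0 < e ->
  \forall h \near (0 : E), `|F (h + x) - F x - 'D_h F x| <= e * `|h|.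
Proof.
move=> Fd e0; have [_ Fe] := (diff_locallyP _ _).1 Fd.
have /eqaddoP/(_ e e0) := Fe; apply: filterS => h /=.
by rewrite deriveE// opprD addrA.
Qed.

Lemma near_eq_differentiable (R : realType) (E W : normedModType R)
    (F G : E -> W) x :
  (\forall y \near x, F y = G y) -> differentiable F x -> differentiable G x.
Proof.
move=> FG Fd; have Fx := nbhs_singleton FG.
have [Fc Fe] := (diff_locallyP _ _).1 Fd.
have Ge : G \o shift x = cst (G x) + 'd F x +o_ 0 id.
  apply/eqaddoP => e e0; have /eqaddoP/(_ e e0) := Fe.
  have := near_translate FG; apply: filterS2 => y /= FGy.
  by rewrite !fctE /= FGy Fx.
apply/diff_locallyP; have -> // : 'd G x = 'd F x :> (E -> W).
exact: diff_unique.
Qed.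

(** * Schwarz's theorem *)

Section Schwarz.
Variables (R : realType) (E : normedModType R).

(** By the mean value theorem the second difference is t times an increment of
    ['D_u F] over the displacement [t *: v], up to an error that the
    differentiability of ['D_u F] at [x] makes o(t^2). *)
Lemma second_difference_bound (F : E -> R) (x u v : E) :
  (\forall y \near x, differentiable F y) -> differentiable ('D_u F) x ->
  forall e, 0 < e -> \forall t \near (0 : R)^'+,
  `|F (t *: u + t *: v + x) - F (t *: u + x) - F (t *: v + x) + F x
   - t ^+ 2 * 'D_v ('D_u F) x| <= e * t ^+ 2.
Proof.
move=> Fd dFd e e0.
(* N t bounds the two displacements met below, with room to spare when u = v = 0 *)
set N := 2 * (`|u| + `|v|) + 1.
have N0 : 0 < N by rewrite /N; have := normr_ge0 u; have := normr_ge0 v; lra.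
have eN : 0 < e / N by rewrite divr_gt0.
have [L LE] : exists L : {linear E -> R}, forall h, 'D_h ('D_u F) x = L h.
  by exists ('d ('D_u F) x) => h; rewrite deriveE.
have H : \forall h \near (0 : E),
    `|'D_u F (h + x) - 'D_u F x - L h| <= e / N * `|h|.
  by have := differentiable_bound dFd eN; apply: filterS => h; rewrite LE.
have {}H : \forall h \near (0 : E), differentiable F (h + x) /\
    `|'D_u F (h + x) - 'D_u F x - L h| <= e / N * `|h|.
  have := @near_translate _ _ x (fun y => differentiable F y) Fd.
  by move: H; apply: filterS2.
have [r /= r0 Hr] := (@nbhs_norm0P _ _ _).1 H.
near=> t.
have t0 : 0 < t by near: t; exact: nbhs_right_gt.
have tr : t * N < r.
  by rewrite -ltr_pdivlMr//; near: t; apply: nbhs_right_lt; rewrite divr_gt0.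
have small s w : 0 <= s <= t -> `|w| <= t * `|v| -> `|s *: u + w| < r.
  move=> /andP[s0 st] wt; apply: le_lt_trans tr.
  rewrite (le_trans (ler_normD _ _))// normrZ ger0_norm//.
  have : s * `|u| <= t * `|u| by rewrite ler_wpM2r.
  rewrite /N; have := mulr_ge0 (ltW t0) (normr_ge0 u).
  have := mulr_ge0 (ltW t0) (normr_ge0 v); nra.
pose phi s := F (s *: u + t *: v + x) - F (s *: u + x).
pose dphi s := 'D_u F (s *: u + t *: v + x) - 'D_u F (s *: u + x).
have phid s : 0 <= s <= t -> is_derive s (1 : R) phi (dphi s).
  move=> st; have tv : `|t *: v| <= t * `|v| by rewrite normrZ (gtr0_norm t0) lexx.
  have z : `|0 : E| <= t * `|v| by rewrite normr0 mulr_ge0 // ltW.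
  have [d1 _] := Hr _ (small _ _ st tv).
  have [] := Hr _ (small _ _ st z); rewrite addr0 => d2 _.
  have aux w : differentiable F (s *: u + w) ->
      is_derive s (1 : R) (fun y => F (y *: u + w)) ('D_u F (s *: u + w)).
    move=> /(@diff_derivable _ _ _ _ _ u)/derivableP.
    apply: is_derive_along_line; near=> h; congr F.
    by rewrite [h *: 1]mulr1 scalerDl addrA.
  apply: is_derive_sub; last exact: aux.
  by under eq_fun do rewrite -addrA; rewrite -addrA; apply: aux; rewrite addrA.
have [||c] := @MVT R phi dphi 0 t t0.
- by move=> c; rewrite in_itv/= => /andP[c0 ct]; apply: phid; rewrite !ltW.
- apply: derivable_within_continuous => c; rewrite in_itv/= => ct.
  by case: (phid c ct).
rewrite in_itv/= => /andP[c0 ct]; rewrite subr0 /phi scale0r !add0r => Ec.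
have -> : F (t *: u + t *: v + x) - F (t *: u + x) - F (t *: v + x) + F x
    = dphi c * t by rewrite -Ec; ring.
have cE : 0 <= c <= t by rewrite !ltW.
have tv : `|t *: v| <= t * `|v| by rewrite normrZ (gtr0_norm t0) lexx.
have z : `|0 : E| <= t * `|v| by rewrite normr0 mulr_ge0// ltW.
have [_] := Hr _ (small _ _ cE tv).
have [_] := Hr _ (small _ _ cE z).
have LDE w : L (c *: u + w) = c * L u + L w by rewrite linearP.
have LtE : L (t *: v) = t * L v by rewrite linearZ.
rewrite (LDE 0) (LDE (t *: v)) LtE linear0 !addr0 LE /dphi.
move: ('D_u F (c *: u + x)) ('D_u F (c *: u + _ + x)) ('D_u F x) => p q o.
move: (L u) (L v) => a b H1 H2.
have cu : `|c *: u| <= t * `|u|.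
  by rewrite normrZ gtr0_norm// ler_wpM2r// ltW.
have B1 : `|p - o - c * a| <= e / N * (t * `|u|).
  by apply: le_trans H1 _; rewrite ler_wpM2l ?(ltW eN).
have B2 : `|q - o - (c * a + t * b)| <= e / N * (t * `|u| + t * `|v|).
  apply: le_trans H2 _; rewrite ler_wpM2l ?(ltW eN)//.
  by rewrite (le_trans (ler_normD _ _))// lerD.
have -> : (q - p) * t - t ^+ 2 * b
    = ((q - o - (c * a + t * b)) - (p - o - c * a)) * t by ring.
rewrite normrM (gtr0_norm t0) expr2 mulrA ler_wpM2r ?(ltW t0)//.
apply: le_trans (ler_normB _ _) _; apply: le_trans (lerD B2 B1) _.
rewrite -mulrDr [e / N]mulrC -mulrA ler_pdivrMl// mulrCA.
rewrite (ler_pM2l e0) /N.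
by have := normr_ge0 u; have := normr_ge0 v; nra.
Unshelve. all: by end_near. Qed.

(** The second difference is symmetric in [u] and [v], and t^2 times each of the
    two mixed derivatives approximates it. *)
Lemma derive_comm (F : E -> R) (x u v : E) :
  (\forall y \near x, differentiable F y) ->
  differentiable ('D_u F) x -> differentiable ('D_v F) x ->
  'D_v ('D_u F) x = 'D_u ('D_v F) x.
Proof.
move=> Fd ud vd.
have := @second_difference_bound F x u v Fd ud.
have := @second_difference_bound F x v u Fd vd.
move: ('D_v ('D_u F) x) ('D_u ('D_v F) x) => a b Hb Ha.
apply/eqP; rewrite -subr_eq0 -normr_le0.
apply/ler_addgt0Pl => e e0; rewrite addr0.
have e2 : 0 < e / 2 by rewrite divr_gt0.
near (0 : R)^'+ => t.
have t0 : 0 < t by near: t; exact: nbhs_right_gt.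
have B1 : `|F (t *: u + t *: v + x) - F (t *: u + x) - F (t *: v + x) + F x
   - t ^+ 2 * a| <= e / 2 * t ^+ 2.
  by near: t; exact: Ha.
have B2 : `|F (t *: v + t *: u + x) - F (t *: v + x) - F (t *: u + x) + F x
   - t ^+ 2 * b| <= e / 2 * t ^+ 2.
  by near: t; exact: Hb.
have t2 : 0 < t ^+ 2 by rewrite exprn_gt0.
move: B1 B2; rewrite (addrC (t *: v) (t *: u)).
move: (F _) (F _) (F _) (F _) => p q r s B1 B2.
have B := le_trans (ler_normB _ _) (lerD B2 B1).
rewrite -(ler_pM2l t2) -{1}(gtr0_norm t2) -normrM.
move: B; rewrite (_ : _ * t ^+ 2 + _ = t ^+ 2 * e); last by field.
by congr (`|_| <= _); ring.
Unshelve. all: by end_near. Qed.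
End Schwarz.

(** * Smooth functions on an open set *)

Section SmoothFunctions.
Variables (R : realType) (n : nat) (V : set 'rV[R]_n).
Hypothesis V_open : open V.
Implicit Types (F G : 'rV[R]_n -> R) (x v : 'rV[R]_n).

Lemma near_open (P : set 'rV[R]_n) x :
  V x -> (forall y, V y -> P y) -> \forall y \near x, P y.
Proof.
by move=> Vx VP; apply: (filterS VP); exact: open_nbhs_nbhs.
Qed.

(** The directions of differentiation range over all vectors, so that the
    class of smooth functions is closed under every ['D_v], not only under the
    partial derivatives. *)
Fixpoint Ck (k : nat) F : Prop :=
  (forall x, V x -> differentiable F x) /\
  (if k is k'.+1 then forall v, Ck k' ('D_v F) else True).

Lemma Ck_differentiable k F x : Ck k F -> V x -> differentiable F x.
Proof. by case: k => [|k] [Fd _]; exact: Fd. Qed.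

Lemma Ck_derivable k F x v : Ck k F -> V x -> is_derive x v F ('D_v F x).
Proof.
move=> Fk Vx; apply: derivableP; apply: diff_derivable.
exact: Ck_differentiable Fk Vx.
Qed.

Lemma CkW k F : Ck k.+1 F -> Ck k F.
Proof. by elim: k F => [|k IH] F [Fd dF]; split=> // v; exact: IH. Qed.

Lemma Ck_derive k F v : Ck k.+1 F -> Ck k ('D_v F).
Proof. by move=> [_ /(_ v)]. Qed.

Lemma Ck_ext k F G : (forall x, V x -> F x = G x) -> Ck k F -> Ck k G.
Proof.
elim: k F G => [|k IH] F G FG Fk.
  split=> // x Vx; apply: near_eq_differentiable (Ck_differentiable Fk Vx).
  exact: near_open.
split=> [x Vx|v].
  apply: near_eq_differentiable (Ck_differentiable Fk Vx).
  exact: near_open.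
have := Ck_derive v Fk; apply: IH => x Vx; apply: near_eq_derive.
exact: near_open.
Qed.

Lemma Ck_cst k (a : R) : Ck k (fun=> a).
Proof.
elim: k a => [|k IH] a; split=> // v.
by apply: (Ck_ext _ (IH 0)) => x _; rewrite derive_cst.
Qed.

Lemma Ck_add k F G : Ck k F -> Ck k G -> Ck k (fun y => F y + G y).
Proof.
elim: k F G => [|k IH] F G Fk Gk.
  by split=> // x Vx; apply: differentiableD; [case: Fk|case: Gk]; auto.
split=> [x Vx|v]; first by apply: differentiableD; [case: Fk|case: Gk]; auto.
have := IH _ _ (Ck_derive v Fk) (Ck_derive v Gk); apply: Ck_ext => x Vx.
have Fd := Ck_derivable v Fk Vx; have Gd := Ck_derivable v Gk Vx.
by have [_ ->] := is_derive_add Fd Gd.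
Qed.

Lemma Ck_mul k F G : Ck k F -> Ck k G -> Ck k (fun y => F y * G y).
Proof.
elim: k F G => [|k IH] F G Fk Gk.
  by split=> // x Vx; apply: differentiableM; [case: Fk|case: Gk]; auto.
split=> [x Vx|v]; first by apply: differentiableM; [case: Fk|case: Gk]; auto.
have := Ck_add (IH _ _ (Ck_derive v Fk) (CkW Gk)) (IH _ _ (CkW Fk) (Ck_derive v Gk)).
apply: Ck_ext => x Vx; apply/esym.
have Fd := Ck_derivable v Fk Vx; have Gd := Ck_derivable v Gk Vx.
by case: (is_derive_mul Fd Gd).
Qed.

Lemma Ck_inv k F : (forall x, V x -> F x != 0) -> Ck k F ->
  Ck k (fun y => (F y)^-1).
Proof.
move=> F0; elim: k => [|k IH] Fk.
  by split=> // x Vx; apply: differentiableV; [case: Fk; auto | exact: F0].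
split=> [x Vx|v]; first by apply: differentiableV; [case: Fk; auto | exact: F0].
have FV := IH (CkW Fk).
have := Ck_mul (Ck_mul (Ck_cst k (- 1)) (Ck_mul FV FV)) (Ck_derive v Fk).
apply: Ck_ext => x Vx; rewrite deriveV ?F0//; last first.
  by case: (Ck_derivable v Fk Vx).
rewrite -[X in _ = X]/(_ * _) expr2 invfM; ring.
Qed.

Lemma Ck_bigsum k (I : finType) (F : I -> 'rV[R]_n -> R) :
  (forall i, Ck k (F i)) -> Ck k (fun y => \sum_i F i y).
Proof.
move=> Fk; rewrite (_ : (fun y => _) = \sum_i F i); last first.
  by apply/funext => y; rewrite fct_sumE.
by elim/big_ind : _ => [|G H|i _]; [exact: Ck_cst | exact: Ck_add | exact: Fk].
Qed.

Lemma Ck_bigprod k (I : finType) (F : I -> 'rV[R]_n -> R) :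
  (forall i, Ck k (F i)) -> Ck k (fun y => \prod_i F i y).
Proof.
move=> Fk; elim: (index_enum I) => [|i r IH].
  by apply: Ck_ext (Ck_cst k 1) => x _; rewrite big_nil.
by apply: Ck_ext (Ck_mul (Fk i) IH) => x _; rewrite big_cons.
Qed.

Lemma Ck_derivable_mx k p q (A : 'rV[R]_n -> 'M[R]_(p, q)) x v :
  (forall i j, Ck k (fun y => A y i j)) -> V x ->
  is_derive x v A ('D_v A x).
Proof.
move=> Ak Vx; apply: derivableP; apply/derivable_mxP => i j.
by case: (Ck_derivable v (Ak i j) Vx).
Qed.

(** By Cramer's rule the entries of the inverse are polynomials in the entries
    divided by the determinant. *)
Lemma Ck_invmx k p (A : 'rV[R]_n -> 'M[R]_p) :
  (forall y, V y -> A y \in unitmx) -> (forall i j, Ck k (fun y => A y i j)) ->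
  forall i j, Ck k (fun y => invmx (A y) i j).
Proof.
have Ck_det q (B : 'rV[R]_n -> 'M[R]_q) : (forall i j, Ck k (fun y => B y i j)) ->
    Ck k (fun y => \det (B y)).
  move=> Bk; apply: Ck_bigsum => s; apply: Ck_mul; first exact: Ck_cst.
  by apply: Ck_bigprod => i.
move=> Au Ak i j.
have := Ck_mul (Ck_inv _ (Ck_det _ _ Ak)) (Ck_mul (Ck_cst k ((-1) ^+ (j + i)))
  (Ck_det _ (fun y => row' j (col' i (A y))) _)).
move=> H; apply: Ck_ext (H _ _) => [y Vy|y Vy|r s].
- by rewrite /invmx Au// !mxE.
- by rewrite -unitfE -unitmxE Au.
- by under eq_fun do rewrite !mxE.
Qed.

Definition smooth F := forall k, Ck k F.

Lemma smooth_on_smooth F : smooth_on V F -> smooth F.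
Proof.
move=> Fs k; elim: k F Fs => [|k IH] F Fs; first by split=> // x /(Fs [::]).
split=> [x /(Fs [::])//|v].
have pk i : Ck k (partial i F).
  by apply: IH => s x Vx; rewrite -foldr_rcons; exact: Fs.
have := Ck_bigsum (fun i => Ck_mul (Ck_cst k (v 0 i)) (pk i)).
apply: Ck_ext => x Vx.
have Fd : differentiable F x by exact: (Fs [::]).
rewrite [in RHS](row_sum_delta v) deriveE// linear_sum; apply: eq_bigr => i _.
by rewrite linearZ /= /partial deriveE.
Qed.
End SmoothFunctions.

(* Proves an equality of sums of matrix products, each product being an atom; [set]
   identifies products whose ring structures are only convertible. *)
Ltac mx_abel :=
  rewrite ?(mulmxDl, mulmxDr, mulmxBl, mulmxBr, mulNmx, mulmxN, mulmxA);
  rewrite ?(mulmxDl, mulmxDr, mulmxBl, mulmxBr, mulNmx, mulmxN, mulmxA);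
  repeat match goal with |- context [@mulmx ?R ?m ?n ?p ?A ?B] =>
    let t := fresh "t" in set t := (@mulmx R m n p A B); clearbody t end;
  apply/matrixP => ? ?; rewrite !mxE; ring.

Lemma trmxD (R : realType) p q (A B : 'M[R]_(p, q)) : (A + B)^T = A^T + B^T.
Proof. exact: raddfD. Qed.

Lemma trmxB (R : realType) p q (A B : 'M[R]_(p, q)) : (A - B)^T = A^T - B^T.
Proof. exact: raddfB. Qed.

Section SmoothMatrices.
Variables (R : realType) (n : nat) (V : set 'rV[R]_n).
Hypothesis V_open : open V.

Definition smooth_mx p q (A : 'rV[R]_n -> 'M[R]_(p, q)) :=
  forall k i j, Ck V k (fun y => A y i j).

Lemma smooth_mx_derive p q (A : 'rV[R]_n -> 'M[R]_(p, q)) x v :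
  smooth_mx A -> V x -> is_derive x v A ('D_v A x).
Proof. by move=> As; exact: Ck_derivable_mx (As 0%N). Qed.

Lemma smooth_mx_derive_entry p q (A : 'rV[R]_n -> 'M[R]_(p, q)) x v i j :
  smooth_mx A -> V x -> 'D_v A x i j = 'D_v (fun y => A y i j) x.
Proof.
move=> As Vx; rewrite derive_mx ?mxE//.
by case: (smooth_mx_derive v As Vx).
Qed.

Lemma smooth_mxD p q (A : 'rV[R]_n -> 'M[R]_(p, q)) v :
  smooth_mx A -> smooth_mx ('D_v A).
Proof.
move=> As k i j; apply: Ck_ext (Ck_derive v (As k.+1 i j)) => // x Vx.
by rewrite smooth_mx_derive_entry.
Qed.

Lemma smooth_mx_derive_comm p q (A : 'rV[R]_n -> 'M[R]_(p, q)) x u v :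
  smooth_mx A -> V x -> 'D_u ('D_v A) x = 'D_v ('D_u A) x.
Proof.
move=> As Vx; apply/matrixP => i j.
have E w z : 'D_w ('D_z A) x i j = 'D_w ('D_z (fun y => A y i j)) x.
  apply: etrans (smooth_mx_derive_entry _ _ _ (smooth_mxD z As) Vx) _.
  apply: near_eq_derive; apply: (near_open V_open Vx) => y Vy.
  exact: smooth_mx_derive_entry.
apply: (etrans (E u v)); apply: (etrans _ (esym (E v u))).
apply: derive_comm.
- by apply: (near_open V_open Vx) => y; exact: Ck_differentiable (As 0%N i j).
- exact: Ck_differentiable (Ck_derive v (As 1%N i j)) Vx.
- exact: Ck_differentiable (Ck_derive u (As 1%N i j)) Vx.
Qed.
End SmoothMatrices.

(** * The Levi-Civita connection in a coordinate domain *)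

Section LeviCivita.
Variables (R : realType) (N : nat).
Implicit Types (g : 'rV[R]_N -> 'M[R]_N) (x u v : 'rV[R]_N).

Local Notation e_ i := (delta_mx 0 i : 'rV[R]_N).

(** The Levi-Civita connection is the only one that is torsion-free and metric:
    in the combination of derivatives of [g] that defines the Christoffel symbols
    all terms but two cancel by the symmetry of [C]. *)
Lemma christoffel_unique g x (C : 'I_N -> 'I_N -> 'rV[R]_N) :
  (g x)^T = g x -> g x \in unitmx -> (forall i j, C i j = C j i) ->
  (forall k i j, partial k (fun y => g y i j) x
                 = (C k i *m g x) 0 j + (C k j *m g x) 0 i) ->
  forall i j h, christoffel g x i j h = C i j 0 h.
Proof.
move=> gs gu Cs Cg i j h; rewrite /christoffel.
under eq_bigr => m _.
  rewrite !Cg (Cs m i) (Cs m j) (Cs j i).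
  rewrite (_ : _ - _ = 2 * (C i j *m g x) 0 m); last by ring.
  rewrite mulrCA; over.
rewrite -mulr_sumr mulKf ?pnatr_eq0//.
rewrite -[in RHS](mulmxK gu (C i j)) [in RHS]mxE; apply: eq_bigr => m _.
have invs : (invmx (g x))^T = invmx (g x) by rewrite trmx_inv gs.
by rewrite mulrC -{1}invs [_^T _ _]mxE.
Qed.

(** A pseudo-Riemannian metric on the open set [V]. *)
Record local_metric (V : set 'rV[R]_N) g : Prop := LocalMetric {
  lm_open : open V;
  lm_smooth : smooth_mx V g;
  lm_sym : forall x, V x -> (g x)^T = g x;
  lm_unit : forall x, V x -> g x \in unitmx }.

(** The endomorphism [X |-> nabla_Y X - D_Y X], as a matrix acting on columns. *)
Definition conn g (Y : 'rV[R]_N) x : 'M[R]_N :=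
  \matrix_(r, j) \sum_s Y 0 s * christoffel g x s j r.

(** The curvature endomorphism R(u, v), as a matrix acting on columns; unlike
    [riemann], it takes arbitrary vectors [u] and [v]. *)
Definition curv g x u v : 'M[R]_N :=
  'D_u (conn g v) x - 'D_v (conn g u) x
  + conn g u x *m conn g v x - conn g v x *m conn g u x.

Lemma conn0 g x : conn g 0 x = 0.
Proof.
by apply/matrixP => i j; rewrite !mxE big1// => k _; rewrite mxE mul0r.
Qed.

Section Metric.
Variables (V : set 'rV[R]_N) (g : 'rV[R]_N -> 'M[R]_N).
Hypothesis gV : local_metric V g.
Let Vo := lm_open gV.

Lemma partial_metric_sym x k i j : V x ->
  partial k (fun y => g y i j) x = partial k (fun y => g y j i) x.
Proof.
move=> Vx; apply: near_eq_derive; apply: (near_open Vo Vx) => y Vy.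
by rewrite -{1}(lm_sym gV Vy) mxE.
Qed.

Lemma christoffel_sym x i j h : V x ->
  christoffel g x i j h = christoffel g x j i h.
Proof.
move=> Vx; rewrite /christoffel; congr (_ * _); apply: eq_bigr => m _.
congr (_ * _).
rewrite (partial_metric_sym m i j Vx) (partial_metric_sym i m j Vx).
by rewrite (partial_metric_sym j i m Vx) [X in X - _]addrC.
Qed.

Lemma christoffel_Ck k i j h : Ck V k (fun y => christoffel g y i j h).
Proof.
have pk a b c : Ck V k (fun y => partial a (fun y => g y b c) y).
  exact: Ck_derive (lm_smooth gV k.+1 b c).
apply: Ck_mul; [exact: Vo|exact: Ck_cst|apply: Ck_bigsum => // m].
apply: Ck_mul => //.
  apply: Ck_invmx => //; first exact: (lm_unit gV).
  by move=> a b; exact: (lm_smooth gV).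
apply: Ck_ext (Ck_add Vo (Ck_add Vo (pk i m j) (pk j i m))
  (Ck_mul Vo (Ck_cst Vo k (-1)) (pk m i j))) => // x Vx.
by rewrite mulN1r.
Qed.

Lemma conn_smooth Y : smooth_mx V (conn g Y).
Proof.
move=> k r j; under eq_fun do rewrite mxE.
apply: Ck_bigsum => // s; apply: Ck_mul => //; first exact: Ck_cst.
exact: christoffel_Ck.
Qed.

Lemma lower_christoffel x k i j : V x ->
  \sum_s g x j s * christoffel g x k i s
  = 2^-1 * (partial k (fun y => g y j i) x + partial i (fun y => g y k j) x
            - partial j (fun y => g y k i) x).
Proof.
move=> Vx; rewrite /christoffel.
under eq_bigr do rewrite mulrCA mulr_sumr.
rewrite -mulr_sumr exchange_big/=; congr (_ * _).
under eq_bigr => m _.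
  under eq_bigr => s _ do rewrite mulrA.
  rewrite -mulr_suml.
  rewrite (_ : \sum_i _ = (g x *m invmx (g x)) j m); last by rewrite mxE.
  rewrite mulmxV ?(lm_unit gV)// mxE; over.
rewrite (bigD1 j)//= eqxx mul1r big1 ?addr0// => m /negbTE mj.
by rewrite eq_sym mj mul0r.
Qed.

Lemma partial_metric x k i j : V x ->
  partial k (fun y => g y i j) x
  = \sum_s (christoffel g x k i s * g x s j + g x i s * christoffel g x k j s).
Proof.
move=> Vx; rewrite big_split/=.
under eq_bigr => s _.
  rewrite mulrC -{1}(lm_sym gV Vx) mxE; over.
rewrite !lower_christoffel// (partial_metric_sym k j i)//.
by rewrite (partial_metric_sym i k j)// (partial_metric_sym j k i)//; field.
Qed.

Lemma is_derive_dir p q (A : 'rV[R]_N -> 'M[R]_(p, q)) x u i j :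
  smooth_mx V A -> V x ->
  'D_u A x i j = \sum_k u 0 k * partial k (fun y => A y i j) x.
Proof.
move=> As Vx; have d := Ck_differentiable (As 0%N i j) Vx.
apply: (etrans (smooth_mx_derive_entry u i j As Vx)).
rewrite deriveE// (row_sum_delta u) linear_sum; apply: eq_bigr => k _.
by rewrite linearZ /partial deriveE// -row_sum_delta.
Qed.

Lemma derive_metric x u : V x ->
  'D_u g x = (conn g u x)^T *m g x + g x *m conn g u x.
Proof.
move=> Vx; apply/matrixP => i j.
rewrite (is_derive_dir u i j (lm_smooth gV) Vx).
rewrite !mxE -big_split/=.
under eq_bigr do rewrite partial_metric// mulr_sumr.
rewrite exchange_big; apply: eq_bigr => s _.
rewrite !mxE mulr_suml mulr_sumr -big_split/=; apply: eq_bigr => k _.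
ring.
Qed.

Lemma is_derive_inv_metric x u : V x ->
  is_derive x u (fun y => invmx (g y))
    (- (invmx (g x) *m (conn g u x)^T + conn g u x *m invmx (g x))).
Proof.
move=> Vx.
have gis : smooth_mx V (fun y => invmx (g y)).
  move=> k i j; apply: Ck_invmx => //; first exact: (lm_unit gV).
  by move=> a b; exact: (lm_smooth gV).
have id := smooth_mx_derive u gis Vx.
have gd := smooth_mx_derive u (lm_smooth gV) Vx; rewrite derive_metric// in gd.
have P := is_derive_mulmx gd id.
(* the product of g and its inverse is constant *)
have Q : is_derive x u (fun y => g y *m invmx (g y)) (0 : 'M[R]_N).
  have C := is_derive_const (1%:M : 'M[R]_N) x u.
  apply: near_eq_is_derive C.
  by apply: (near_open Vo Vx) => y Vy; rewrite mulmxV ?(lm_unit gV).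
suff -> : - (invmx (g x) *m (conn g u x)^T + conn g u x *m invmx (g x))
    = 'D_u (fun y => invmx (g y)) x by [].
have := etrans (esym (@derive_val _ _ _ _ _ _ _ P)) (@derive_val _ _ _ _ _ _ _ Q).
move: ('D_u _ x) => D; move: (lm_unit gV Vx).
move: (g x) (conn g u x) => h c hu.
move=> /(congr1 (mulmx (invmx h))).
rewrite mulmx0 !mulmxDr !mulmxDl !mulmxDr -!mulmxA (mulmxA (invmx h) h D).
rewrite mulVmx// mul1mx mulmxV// mulmx1 (mulmxA (invmx h) h) mulVmx// mul1mx.
by move=> /eqP; rewrite addrC addr_eq0 => /eqP ->.
Qed.

Lemma conn_sym x u v : V x -> conn g u x *m v^T = conn g v x *m u^T.
Proof.
move=> Vx; apply/matrixP => r j; rewrite !mxE.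
under eq_bigr do rewrite !mxE mulr_suml.
rewrite exchange_big; apply: eq_bigr => s _.
rewrite !mxE mulr_suml; apply: eq_bigr => k _.
by rewrite (christoffel_sym _ k)// (ord1 j); ring.
Qed.

(** Differentiating [derive_metric] once more and antisymmetrizing: the second
    derivatives of [g] commute, and what remains is this identity. *)
Lemma curv_skew x u v : V x ->
  (curv g x u v)^T *m g x + g x *m curv g x u v = 0.
Proof.
move=> Vx; have gs := lm_smooth gV.
have D w z : 'D_w ('D_z g) x
    = ('D_w (conn g z) x)^T *m g x
      + (conn g z x)^T *m ((conn g w x)^T *m g x + g x *m conn g w x)
      + (((conn g w x)^T *m g x + g x *m conn g w x) *m conn g z x
         + g x *m 'D_w (conn g z) x).
  apply: (etrans (y := 'D_w (fun y => (conn g z y)^T *m g y + g y *m conn g z y) x)).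
    by apply: near_eq_derive; apply: (near_open Vo Vx) => y; exact: derive_metric.
  have gd := smooth_mx_derive w gs Vx; rewrite derive_metric// in gd.
  have cd := smooth_mx_derive w (conn_smooth z) Vx.
  by have [_] := is_derive_add (is_derive_mulmx (is_derive_trmx cd) gd)
    (is_derive_mulmx gd cd).
have := smooth_mx_derive_comm Vo u v gs Vx.
move=> C; have {}C := etrans (esym (D u v)) (etrans C (D v u)).
move/eqP: C; rewrite -subr_eq0 => /eqP; apply: etrans.
rewrite /curv.
move: ('D_u (conn g v) x) ('D_v (conn g u) x) => P Q.
move: (conn g u x) (conn g v x) (g x) => U W h.
rewrite !(trmxB, trmxD, trmx_mul); mx_abel.
Qed.

Lemma curvE x u v r j : V x ->
  curv g x u v r j = \sum_m \sum_l u 0 m * v 0 l * riemann g x m l j r.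
Proof.
move=> Vx.
have D w z : 'D_w (conn g z) x r j
   = \sum_m \sum_l w 0 m * z 0 l * partial m (fun y => christoffel g y l j r) x.
  rewrite (is_derive_dir w r j (conn_smooth z) Vx); apply: eq_bigr => m _.
  rewrite -[partial _ _ _]/('D__ _ _); under eq_fun do rewrite mxE.
  have [_ ->] : is_derive x (e_ m) (fun y => \sum_l z 0 l * christoffel g y l j r)
     (\sum_l z 0 l * partial m (fun y => christoffel g y l j r) x).
    apply: is_derive_bigsum => l.
    have := is_derive_mul (is_derive_const (z 0 l) x (e_ m))
      (Ck_derivable (e_ m) (christoffel_Ck 0 l j r) Vx).
    by rewrite mul0r add0r.
  by rewrite mulr_sumr; apply: eq_bigr => l _; rewrite mulrA.
have P w z : (conn g w x *m conn g z x) r j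
   = \sum_m \sum_l w 0 m * z 0 l *
       \sum_s christoffel g x m s r * christoffel g x l j s.
  rewrite mxE; under eq_bigr do rewrite !mxE mulr_suml.
  rewrite exchange_big; apply: eq_bigr => m _ /=.
  under eq_bigr do rewrite mulr_sumr.
  rewrite exchange_big; apply: eq_bigr => l _ /=.
  by rewrite mulr_sumr; apply: eq_bigr => s _; ring.
have E (A B C D' : 'M[R]_N) :
  (A - B + C - D') r j = A r j - B r j + C r j - D' r j by rewrite !mxE.
rewrite /curv; move: (D u v) (D v u).
move: ('D_u (conn g v) x) ('D_v (conn g u) x) => A B HA HB.
rewrite E HA HB !P [X in _ - X + _ - _]exchange_big [X in _ - X]exchange_big/=.
rewrite -sumrB -big_split -sumrB; apply: eq_bigr => m _ /=.
rewrite -sumrB -big_split -sumrB; apply: eq_bigr => l _ /=.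
rewrite /riemann sumrB.
by move: (partial m _ x) (partial l _ x) (\sum_s _) (\sum_s _) => a b c d; ring.
Qed.

Lemma curv_delta x m l r j : V x -> curv g x (e_ m) (e_ l) r j = riemann g x m l j r.
Proof.
move=> Vx; rewrite curvE// (bigD1 m)//= (bigD1 l)//= big1 => [|k /negbTE kl].
  rewrite big1 => [|k /negbTE km]; first by rewrite !mxE !eqxx !mul1r !addr0.
  by apply: big1 => i _; rewrite mxE km !mul0r.
by rewrite !mxE kl mulr0 mul0r.
Qed.

Lemma curv_eq0 x : V x -> (forall m l j r, riemann g x m l j r = 0) ->
  forall u v, curv g x u v = 0.
Proof.
move=> Vx R0 u v; apply/matrixP => r j; rewrite curvE// mxE.
by apply: big1 => m _; apply: big1 => l _; rewrite R0 mulr0.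
Qed.
End Metric.

(** * Conformal change of the metric *)

Section Conformal.
Variables (V : set 'rV[R]_N) (g : 'rV[R]_N -> 'M[R]_N) (F : 'rV[R]_N -> R).
Hypothesis gV : local_metric V g.
Hypothesis Fs : smooth V F.
Hypothesis F0 : forall x, V x -> F x != 0.
Let Vo := lm_open gV.

Lemma local_metric_scale : local_metric V (fun y => F y *: g y).
Proof.
split=> // [k i j|x Vx|x Vx].
- under eq_fun do rewrite mxE.
  by apply: Ck_mul => //; exact: (lm_smooth gV).
- by rewrite -[LHS]/(trmx _) linearZ/= (lm_sym gV).
- by rewrite unitmxZ ?unitfE ?F0// (lm_unit gV).
Qed.

Lemma christoffel_scale x i j h : V x ->
  christoffel (fun y => F y *: g y) x i j h
  = christoffel g x i j h + (2 * F x)^-1 * fA g F x i j h.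
Proof.
move=> Vx.
have D a b c : partial a (fun y => (F y *: g y) b c) x
    = partial a F x * g x b c + F x * partial a (fun y => g y b c) x.
  rewrite /partial; under eq_fun do rewrite mxE.
  by have [_ ->] := is_derive_mul (Ck_derivable (e_ a) (Fs 0) Vx)
    (Ck_derivable (e_ a) (lm_smooth gV 0 b c) Vx).
have I a b : \sum_m invmx (g x) a m * g x m b = (a == b)%:R.
  by have := mulVmx (lm_unit gV Vx) => /matrixP/(_ a b); rewrite !mxE.
rewrite /christoffel invmxZ ?unitmxZ ?unitfE ?F0 ?(lm_unit gV)//.
rewrite /fA; set S := \sum_m invmx (g x) h m * partial m F x.
transitivity (2^-1 * \sum_m ((F x)^-1 * (invmx (g x) h m * g x m j * partial i F x
   + invmx (g x) h m * g x m i * partial j F x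
   - invmx (g x) h m * partial m F x * g x i j)
   + invmx (g x) h m * (partial i (fun y => g y m j) x
     + partial j (fun y => g y i m) x - partial m (fun y => g y i j) x))).
  congr (_ * _); apply: eq_bigr => m _; rewrite !D mxE.
  have -> : g x i m = g x m i by rewrite -{1}(lm_sym gV Vx) mxE.
  by field; exact: F0.
rewrite big_split/= -mulr_sumr sumrB big_split/= -!mulr_suml !I -/S.
rewrite (eq_sym h j) (eq_sym h i); field.
by rewrite F0.
Qed.

(** A connection changed by a tensor T changes its curvature by the
    antisymmetrization of nabla T plus the commutator of T; here T is the
    difference of the two Levi-Civita connections, found in
    [christoffel_scale]. *)
Lemma riemann_scale x m l j r : V x ->
  riemann (fun y => F y *: g y) x m l j r = riemann g x m l j r
  + (nabla12 g (fun y l j r => (2 * F y)^-1 * fA g F y l j r) x m l j r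
   - nabla12 g (fun y l j r => (2 * F y)^-1 * fA g F y l j r) x l m j r
   + (4 * F x ^+ 2)^-1 * (\sum_(s < N) fA g F x m s r * fA g F x l j s)
   - (4 * F x ^+ 2)^-1 * (\sum_(s < N) fA g F x l s r * fA g F x m j s)).
Proof.
move=> Vx; set T := fun y l j r => (2 * F y)^-1 * fA g F y l j r.
have chE a b c y : V y -> christoffel (fun y => F y *: g y) y a b c
    = christoffel g y a b c + T y a b c by exact: christoffel_scale.
have D a b c d : partial a (fun y => christoffel (fun y => F y *: g y) y b c d) x
    = partial a (fun y => christoffel g y b c d) x + partial a (fun y => T y b c d) x.
  have := Ck_derivable (e_ a) (christoffel_Ck local_metric_scale 0 b c d) Vx.
  have := Ck_derivable (e_ a) (christoffel_Ck gV 0 b c d) Vx.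
  move=> G1 G2; have := is_derive_sub G2 G1 => -[_].
  have -> : 'D_(e_ a) (fun y => christoffel (fun y => F y *: g y) y b c d
     - christoffel g y b c d) x = 'D_(e_ a) (fun y => T y b c d) x.
    apply: near_eq_derive; apply: (near_open Vo Vx) => y Vy.
    by rewrite chE// addrC addKr.
  by rewrite /partial => ->; rewrite addrC subrK.
rewrite /riemann !D; under eq_bigr do rewrite !chE//.
(* the Christoffel terms carrying the index pair m l cancel by symmetry *)
have sym s : christoffel g x l m s = christoffel g x m l s.
  exact: (christoffel_sym gV).
rewrite /nabla12.
have E : \sum_(s < N)
     ((christoffel g x m s r + T x m s r) * (christoffel g x l j s + T x l j s)
      - (christoffel g x l s r + T x l s r) * (christoffel g x m j s + T x m j s))
   = \sum_(s < N) (christoffel g x m s r * christoffel g x l j s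
                   - christoffel g x l s r * christoffel g x m j s)
   + (\sum_(s < N) (christoffel g x m s r * T x l j s
                  - christoffel g x m l s * T x s j r
                  - christoffel g x m j s * T x l s r)
    - \sum_(s < N) (christoffel g x l s r * T x m j s
                  - christoffel g x l m s * T x s j r
                  - christoffel g x l j s * T x m s r)
    + (4 * F x ^+ 2)^-1 * (\sum_(s < N) fA g F x m s r * fA g F x l j s)
    - (4 * F x ^+ 2)^-1 * (\sum_(s < N) fA g F x l s r * fA g F x m j s)).
  rewrite !mulr_sumr -!(sumrB, big_split)/=.
  apply: eq_bigr => s _; rewrite /T sym.
  move: (fA g F x m s r) (fA g F x l j s) (fA g F x l s r) (fA g F x m j s).
  move: (fA g F x s j r).
  move: (christoffel g x) => G e' a b c d; field.
  by rewrite F0.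
rewrite E -/T.
move: (\sum_s _) (\sum_s _) (\sum_s _) (_^-1 * _) (_^-1 * _) => a b c d e'.
move: (partial m _ x) (partial l _ x) (partial m _ x) (partial l _ x) => p q r' s.
ring.
Qed.
End Conformal.
End LeviCivita.

(** * The Levi-Civita connection of the Sasaki metric *)

Section SasakiCurvature.
Variables (R : realType) (n : nat) (V : set 'rV[R]_n).
Variables (g : 'rV[R]_n -> 'M[R]_n) (F : 'rV[R]_n -> R).
Hypothesis gV : local_metric V g.
Hypothesis Fs : smooth V F.
Hypothesis F0 : forall x, V x -> F x != 0.
Let Vo := lm_open gV.
Local Notation W := 'rV[R]_(n + n * n).
Implicit Types (z u v w : W) (X Y : 'rV[R]_n) (A B : 'M[R]_n).

Lemma mxtrace_eq0 (A : 'M[R]_n) : (forall B, \tr (A *m B) = 0) -> A = 0.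
Proof.
move=> A0; apply/matrixP => i j; rewrite mxE; apply: etrans (A0 (delta_mx j i)).
rewrite mxtrace_mulC /mxtrace (bigD1 j)//= big1 ?addr0 => [|k /negbTE kj].
  rewrite mxE (bigD1 i)//= big1 ?addr0 => [|l /negbTE li]; rewrite mxE.
    by rewrite !eqxx mul1r.
  by rewrite li andbF mul0r.
by rewrite mxE big1// => l _; rewrite mxE kj mul0r.
Qed.

Definition mxcomm A B : 'M[R]_n := A *m B - B *m A.

Lemma mxcomm0r A : mxcomm A 0 = 0.
Proof. by rewrite /mxcomm mulmx0 mul0mx subr0. Qed.

Lemma mxcomm_linearr A : linear (mxcomm A).
Proof.
move=> a B C; rewrite /mxcomm mulmxDl mulmxDr -scalemxAl -scalemxAr.
by rewrite scalerBr addrACA opprD.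
Qed.

Lemma mxcomm_linearl B : linear (mxcomm ^~ B).
Proof.
move=> a A C; rewrite /mxcomm mulmxDl mulmxDr -scalemxAl -scalemxAr.
by rewrite scalerBr addrACA opprD.
Qed.

Lemma is_derive_mxcomm (E : normedModType R) (A B : E -> 'M[R]_n) (x v : E)
    dA dB :
  is_derive x v A dA -> is_derive x v B dB ->
  is_derive x v (fun y => mxcomm (A y) (B y)) (mxcomm dA (B x) + mxcomm (A x) dB).
Proof.
move=> Ad Bd; rewrite /mxcomm addrACA -opprD [B x *m dA + _]addrC.
by apply: is_derive_sub; exact: is_derive_mulmx.
Qed.

Lemma is_derive_base (U : normedModType R) (h : 'rV[R]_n -> U) z w d :
  is_derive (base_coord z) (base_coord w) h d ->
  is_derive z w (fun y => h (base_coord y)) d.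
Proof.
apply: is_derive_along_line; near=> s.
by rewrite /base_coord linearP.
Unshelve. all: by end_near. Qed.

Lemma is_derive_fibre z w : is_derive z w (@fibre_coord R n) (fibre_coord w).
Proof.
apply/is_derive_mxP => i j; rewrite !mxE; under eq_fun do rewrite !mxE.
by have /is_derive_mxP := is_derive_id z w; apply.
Qed.

Lemma hlift_fibreE z X :
  hlift_fibre g z X = mxcomm (fibre_coord z) (conn g X (base_coord z)).
Proof.
apply/matrixP => i j; rewrite !mxE -sumrB.
under eq_bigr do rewrite mulr_sumr.
rewrite exchange_big; apply: eq_bigr => m _ /=.
rewrite !mxE mulr_sumr mulr_suml -sumrB; apply: eq_bigr => s _; ring.
Qed.

(** The connection form of the fibres: the connection of (1,1)-tensors is the
    commutator with the connection matrix of [g]. *)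
Lemma vertical_partE z u :
  vertical_part g z u
  = fibre_coord u + mxcomm (conn g (base_coord u) (base_coord z)) (fibre_coord z).
Proof. by rewrite /vertical_part hlift_fibreE /mxcomm opprB. Qed.

(** The derivative along [w] of the vertical part of a constant vector field
    with horizontal part [X]. *)
Definition dvert z w X : 'M[R]_n :=
  mxcomm ('D_(base_coord w) (conn g X) (base_coord z)) (fibre_coord z)
  + mxcomm (conn g X (base_coord z)) (fibre_coord w).

Lemma is_derive_vertical_part z w u : V (base_coord z) ->
  is_derive z w (fun y => vertical_part g y u) (dvert z w (base_coord u)).
Proof.
move=> Vz; under eq_fun do rewrite vertical_partE.
rewrite -[dvert _ _ _]add0r.
apply: (is_derive_add (is_derive_const (fibre_coord u) z w)).
apply: is_derive_mxcomm; last exact: is_derive_fibre.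
have := smooth_mx_derive (base_coord w) (conn_smooth gV (base_coord u)) Vz.
exact: is_derive_base.
Qed.

(** The vertical part of the covariant derivative along [w] of the constant
    vector field [u]. *)
Definition nabla_vert z w u : 'M[R]_n :=
  dvert z w (base_coord u)
  + mxcomm (conn g (base_coord w) (base_coord z)) (vertical_part g z u).

Let gam y := F y *: g y.
Let gamV : local_metric V gam. Proof. exact: local_metric_scale. Qed.

(** The covariant derivative along [w], for the metric [gam], of the horizontal
    part of the constant vector field [u]. *)
Definition nabla_hor z w u : 'rV[R]_n :=
  base_coord u *m (conn gam (base_coord w) (base_coord z))^T.

(** The direct sum of the two connections, transported by the splitting into
    horizontal and vertical parts; applied to a constant field [u], it gives what
    would be the Christoffel symbols of the Sasaki metric. *)
Definition sasaki_conn z w u : W :=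
  hlift g z (nabla_hor z w u) + vlift (nabla_vert z w u).

Lemma base_sasaki_conn z w u : base_coord (sasaki_conn z w u) = nabla_hor z w u.
Proof. by rewrite /base_coord linearD/= !row_mxKl addr0. Qed.

Lemma vertical_sasaki_conn z w u :
  vertical_part g z (sasaki_conn z w u) = nabla_vert z w u.
Proof.
have := vertical_part_linear g z 1 (hlift g z (nabla_hor z w u))
  (vlift (nabla_vert z w u)).
by rewrite !scale1r => ->; rewrite vertical_part_hlift add0r vertical_part_vlift.
Qed.

(** The horizontal part is symmetric because [gam] is torsion-free; the vertical
    part fails to be so by the curvature of the fibres at [z]. *)
Lemma sasaki_conn_sym z w u : V (base_coord z) ->
  (forall X Y, mxcomm (curv g (base_coord z) X Y) (fibre_coord z) = 0) ->
  sasaki_conn z w u = sasaki_conn z u w.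
Proof.
move=> Vz H; rewrite /sasaki_conn.
have -> : nabla_hor z w u = nabla_hor z u w.
  by apply: trmx_inj; rewrite !trmx_mul !trmxK (conn_sym gamV).
congr (_ + vlift _); apply/eqP; rewrite -subr_eq0; apply/eqP.
apply: etrans (H (base_coord w) (base_coord u)).
rewrite /nabla_vert !vertical_partE /dvert /curv /mxcomm.
move: ('D_(base_coord w) _ _) ('D_(base_coord u) _ _) => P Q.
move: (conn g (base_coord w) _) (conn g (base_coord u) _) (fibre_coord z)
  (fibre_coord u) (fibre_coord w) => S T t a b.
mx_abel.
Qed.

Lemma base_productE x X Y : base_product g x X Y = (X *m g x *m Y^T) 0 0.
Proof.
rewrite mxE /base_product exchange_big; apply: eq_bigr => j _ /=.
rewrite !mxE mulr_suml; apply: eq_bigr => i _; ring.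
Qed.

Lemma fibre_productE x A B :
  fibre_product g x A B = \tr (A^T *m g x *m B *m (invmx (g x))^T).
Proof.
rewrite /fibre_product /mxtrace.
under eq_bigr do rewrite exchange_big/=.
rewrite exchange_big/=; apply: eq_bigr => j _.
under eq_bigr do rewrite exchange_big/=.
rewrite exchange_big mxE/=; apply: eq_bigr => l _.
rewrite exchange_big !mxE mulr_suml/=; apply: eq_bigr => c _.
rewrite !mxE !mulr_suml; apply: eq_bigr => i _.
by rewrite mxE; ring.
Qed.

(** The connection of the fibres preserves their metric, because the one of [g]
    preserves [g] and its inverse. *)
Lemma is_derive_fibre_product z w (A B : W -> 'M[R]_n) dA dB :
  V (base_coord z) -> is_derive z w A dA -> is_derive z w B dB ->
  is_derive z w (fun y => fibre_product g (base_coord y) (A y) (B y))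
    (fibre_product g (base_coord z)
       (dA + mxcomm (conn g (base_coord w) (base_coord z)) (A z)) (B z)
     + fibre_product g (base_coord z)
       (A z) (dB + mxcomm (conn g (base_coord w) (base_coord z)) (B z))).
Proof.
move=> Vz Ad Bd; set x := base_coord z; set Y := base_coord w.
under eq_fun do rewrite fibre_productE.
have gd : is_derive z w (fun y => g (base_coord y))
    ((conn g Y x)^T *m g x + g x *m conn g Y x).
  have := smooth_mx_derive Y (lm_smooth gV) Vz.
  by rewrite (derive_metric gV)//; exact: is_derive_base.
have invs y : V y -> (invmx (g y))^T = invmx (g y).
  by move=> Vy; rewrite trmx_inv (lm_sym gV).
have id0 : is_derive x Y (fun y => (invmx (g y))^T)
    (- (invmx (g x) *m (conn g Y x)^T + conn g Y x *m invmx (g x))).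
  apply: near_eq_is_derive (is_derive_inv_metric gV Y Vz).
  by apply: (near_open Vo Vz) => y Vy; rewrite invs.
have idd := is_derive_base id0.
have D := is_derive_mxtrace (is_derive_mulmx (is_derive_mulmx (is_derive_mulmx
  (is_derive_trmx Ad) gd) Bd) idd).
apply: (@is_derive_eq _ _ _ _ _ _ _ _ D); rewrite !fibre_productE -/x invs//.
move: (g x) (conn g Y x) (invmx (g x)) (A z) (B z) => h c i a b.
(* the two sides differ by the trace of a commutator of [c^T] *)
set p := a^T *m h *m b *m i.
have cyc : \tr (p *m c^T) = \tr (c^T *m p) by exact: mxtrace_mulC.
apply/eqP; rewrite -mxtraceD -subr_eq0 -(subrr (\tr (c^T *m p))) -{2}cyc -!raddfB.
apply/eqP; congr (\tr _); rewrite /p /mxcomm !(trmxB, trmxD, trmx_mul); mx_abel.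
Qed.

(** [sasaki_conn] is metric, since both summands are. *)
Lemma is_derive_sasaki z w u v : V (base_coord z) ->
  is_derive z w (fun y => sasaki_product g F y u v)
    (sasaki_product g F z (sasaki_conn z w u) v
     + sasaki_product g F z u (sasaki_conn z w v)).
Proof.
move=> Vz; have := vertical_sasaki_conn z w v; have := vertical_sasaki_conn z w u.
have := base_sasaki_conn z w v; have := base_sasaki_conn z w u.
rewrite /sasaki_product /horizontal_part -!/(base_coord _).
move: (sasaki_conn z w u) (sasaki_conn z w v) => a b -> -> -> ->; rewrite addrACA.
apply: is_derive_add; last first.
  by apply: is_derive_fibre_product => //; exact: is_derive_vertical_part.
set X := base_coord u; set Y := base_coord v.
have E x (X' Y' : 'rV[R]_n) : F x * base_product g x X' Y' = (X' *m gam x *m Y'^T) 0 0.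
  by rewrite base_productE /gam -scalemxAr -scalemxAl [RHS]mxE.
under eq_fun do rewrite E; rewrite !E.
have gd : is_derive z w (fun y => gam (base_coord y))
    ('D_(base_coord w) gam (base_coord z)).
  have := smooth_mx_derive (base_coord w) (lm_smooth gamV) Vz.
  exact: is_derive_base.
have D := is_derive_mulmx (is_derive_mulmx (is_derive_const X z w) gd)
  (is_derive_const Y^T z w).
have /is_derive_mxP/(_ 0 0) {}D := D.
apply: (@is_derive_eq _ _ _ _ _ _ _ _ D).
rewrite (derive_metric gamV)// /nabla_hor -/X -/Y mul0mx mulmx0 add0r addr0.
have addE (A B : 'M[R]_1) : A 0 0 + B 0 0 = (A + B) 0 0 by rewrite mxE.
rewrite trmx_mul trmxK addE; congr (fun_of_matrix _ 0 0).
move: (conn gam _ _) (gam _) => c h; rewrite ?mulmxA; mx_abel.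
Qed.

Lemma sasaki_productC z u v : V (base_coord z) ->
  sasaki_product g F z u v = sasaki_product g F z v u.
Proof.
move=> Vz; rewrite /sasaki_product; congr (_ * _ + _).
  have tr1 (A : 'M[R]_1) : A 0 0 = A^T 0 0 by rewrite mxE.
  rewrite !base_productE [LHS]tr1 !trmx_mul trmxK.
  by rewrite (lm_sym gV)// mulmxA.
rewrite !fibre_productE -mxtrace_tr !trmx_mul !trmxK (lm_sym gV)//.
by rewrite mxtrace_mulC trmx_inv (lm_sym gV)// !mulmxA.
Qed.

Lemma sasaki_comp_sym z : V (base_coord z) ->
  (sasaki_comp g F z)^T = sasaki_comp g F z.
Proof. by move=> Vz; apply/matrixP => a b; rewrite !mxE sasaki_productC. Qed.

(** A vector orthogonal to all vertical lifts has no vertical part, and then,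
    being orthogonal to all horizontal lifts, no horizontal part. *)
Lemma sasaki_comp_unit z : V (base_coord z) -> sasaki_comp g F z \in unitmx.
Proof.
move=> Vz; rewrite -row_free_unit; apply: inj_row_free => u u0.
have u0' v : sasaki_product g F z u v = 0.
  by rewrite -sasaki_compE u0 mul0mx mxE.
have uE := lift_decomposition g z u.
have vu0 : vertical_part g z u = 0.
  apply: trmx_inj; rewrite trmx0.
  have H B : \tr ((vertical_part g z u)^T *m g (base_coord z) *m B
                   *m invmx (g (base_coord z))) = 0.
    have := u0' (vlift B).
    rewrite /sasaki_product vertical_part_vlift fibre_productE trmx_inv (lm_sym gV)//.
    rewrite /horizontal_part /vlift row_mxKl base_productE trmx0 mulmx0 mxE.
    by rewrite mulr0 add0r.
  apply: mxtrace_eq0 => B.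
  have := H (invmx (g (base_coord z)) *m B *m g (base_coord z)).
  by rewrite !mulmxA mulmxK ?mulmxK ?(lm_unit gV).
have bu0 : base_coord u = 0.
  apply: (can_inj (mulmxK (lm_unit gamV Vz))); apply/rowP => j.
  rewrite mul0mx [RHS]mxE.
  have := u0' (hlift g z (delta_mx 0 j)).
  rewrite /sasaki_product vertical_part_hlift fibre_productE mulmx0 mul0mx mxtrace0.
  rewrite addr0 /horizontal_part row_mxKl base_productE /gam -scalemxAr.
  by rewrite trmx_delta -colE !mxE.
rewrite uE /horizontal_part -/(base_coord u) bu0 vu0.
rewrite /hlift /vlift hlift_fibreE conn0 /mxcomm mulmx0 mul0mx subr0.
by rewrite linear0 row_mx0 addr0.
Qed.

(** The induced connection of the fibres is the commutator with that of [g],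
    so its curvature is the commutator with [curv g].  Where that curvature
    annihilates the point of the fibre, [sasaki_conn] is torsion-free, hence the
    Levi-Civita connection. *)
Lemma sasaki_christoffel z i j h : V (base_coord z) ->
  (forall X Y, mxcomm (curv g (base_coord z) X Y) (fibre_coord z) = 0) ->
  christoffel (sasaki_comp g F) z i j h
  = sasaki_conn z (delta_mx 0 i) (delta_mx 0 j) 0 h.
Proof.
move=> Vz H; move: i j h.
apply: (@christoffel_unique _ _ _ _
  (fun i j => sasaki_conn z (delta_mx 0 i) (delta_mx 0 j))).
- exact: sasaki_comp_sym.
- exact: sasaki_comp_unit.
- by move=> i j; exact: sasaki_conn_sym.
move=> k i j; rewrite /partial; under eq_fun do rewrite mxE.
have [_ ->] := is_derive_sasaki (delta_mx 0 k) (delta_mx 0 i) (delta_mx 0 j) Vz.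
have E u b : (u *m sasaki_comp g F z) 0 b = sasaki_product g F z u (delta_mx 0 b).
  by rewrite -sasaki_compE trmx_delta -colE [RHS]mxE.
move: (sasaki_conn z _ _) (sasaki_conn z _ _) => a b.
by rewrite !E; congr (_ + _); exact: sasaki_productC.
Qed.

Lemma dvert_linear z w : V (base_coord z) -> linear (dvert z w).
Proof.
move=> Vz a X Y.
have cP : forall y, conn g (a *: X + Y) y = a *: conn g X y + conn g Y y.
  move=> y; apply/matrixP => r j; rewrite !mxE mulr_sumr -big_split/=.
  by apply: eq_bigr => s _; rewrite !mxE; ring.
rewrite /dvert cP.
have -> : 'D_(base_coord w) (conn g (a *: X + Y)) (base_coord z)
   = a *: 'D_(base_coord w) (conn g X) (base_coord z)
     + 'D_(base_coord w) (conn g Y) (base_coord z).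
  have -> : conn g (a *: X + Y) = fun y => a *: conn g X y + conn g Y y by exact/funext.
  have dX := smooth_mx_derive (base_coord w) (conn_smooth gV X) Vz.
  have dY := smooth_mx_derive (base_coord w) (conn_smooth gV Y) Vz.
  by have [_] := is_derive_add (is_deriveZ a dX) dY.
move: ('D_(base_coord w) _ _) ('D_(base_coord w) _ _) => P Q.
by rewrite !mxcomm_linearl [a *: (_ + mxcomm _ (fibre_coord w))]scalerDr addrACA.
Qed.

Lemma sasaki_conn_linear z w : V (base_coord z) -> linear (sasaki_conn z w).
Proof.
move=> Vz a u v; rewrite /sasaki_conn.
have -> : nabla_hor z w (a *: u + v) = a *: nabla_hor z w u + nabla_hor z w v.
  by rewrite /nabla_hor /base_coord linearP mulmxDl scalemxAl.
have -> : nabla_vert z w (a *: u + v) = a *: nabla_vert z w u + nabla_vert z w v.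
  rewrite /nabla_vert vertical_part_linear /base_coord linearP dvert_linear//.
  by rewrite mxcomm_linearr [a *: (dvert _ _ _ + _)]scalerDr addrACA.
rewrite /hlift /vlift !hlift_fibre_linear !linearP/=.
by rewrite !add_row_mx !scale_row_mx !add_row_mx; congr row_mx;
  apply/matrixP => r j; rewrite !mxE; ring.
Qed.

Lemma is_derive_conn z w (a : W -> 'rV[R]_n) da :
  V (base_coord z) -> is_derive z w a da ->
  is_derive z w (fun y => conn g (a y) (base_coord y))
    (conn g da (base_coord z)
     + 'D_(base_coord w) (conn g (a z)) (base_coord z)).
Proof.
move=> Vz ad; apply/is_derive_mxP => r j.
under eq_fun do rewrite mxE.
have G s : is_derive (base_coord z) (base_coord w) (fun y => christoffel g y s j r)
    ('D_(base_coord w) (fun y => christoffel g y s j r) (base_coord z)).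
  exact: Ck_derivable (christoffel_Ck gV 0 s j r) Vz.
have Gz s := is_derive_base (G s).
have as' s : is_derive z w (fun y => a y 0 s) (da 0 s).
  by have /is_derive_mxP := ad; apply.
have D := is_derive_bigsum (fun s => is_derive_mul (as' s) (Gz s)).
apply: (@is_derive_eq _ _ _ _ _ _ _ _ D).
rewrite big_split/= mxE [conn _ _ _ _ _]mxE; congr (_ + _).
apply/esym; apply: (etrans (smooth_mx_derive_entry _ _ _ (conn_smooth gV (a z)) Vz)).
under eq_fun do rewrite mxE.
have [_ ->] := is_derive_bigsum (fun s =>
  is_derive_mul (is_derive_const (a z 0 s) (base_coord z) (base_coord w)) (G s)).
by apply: eq_bigr => s _; rewrite mul0r add0r.
Qed.

(** * The curvature of the Sasaki metric *)

Lemma is_derive_row_mx (E : normedModType R) p q (A : E -> 'rV[R]_p)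
    (B : E -> 'rV[R]_q) (x v : E) dA dB :
  is_derive x v A dA -> is_derive x v B dB ->
  is_derive x v (fun y => row_mx (A y) (B y)) (row_mx dA dB).
Proof.
move=> /is_derive_mxP Ad /is_derive_mxP Bd; apply/is_derive_mxP => i j.
rewrite mxE; under eq_fun do rewrite mxE.
by case: (fintype.split j) => k.
Qed.

Lemma is_derive_mxvec (E : normedModType R) p q (A : E -> 'M[R]_(p, q))
    (x v : E) dA :
  is_derive x v A dA -> is_derive x v (fun y => mxvec (A y)) (mxvec dA).
Proof.
move=> /is_derive_mxP Ad; apply/is_derive_mxP => i j; rewrite (ord1 i).
case/mxvec_indexP: j => k l; rewrite mxvecE.
by under eq_fun do rewrite mxvecE.
Qed.

Lemma is_derive_mxcomm_cst (E : normedModType R) (A : E -> 'M[R]_n) B (x v : E) dA :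
  is_derive x v A dA -> is_derive x v (fun y => mxcomm (A y) B) (mxcomm dA B).
Proof.
move=> Ad; have := is_derive_mxcomm Ad (is_derive_const B x v).
by rewrite mxcomm0r addr0.
Qed.

(** The derivative of [dvert _ w' X] along [w], a second derivative of the
    vertical part of a constant vector field. *)
Definition ddvert z w w' X : 'M[R]_n :=
  mxcomm ('D_(base_coord w) ('D_(base_coord w') (conn g X)) (base_coord z))
    (fibre_coord z)
  + mxcomm ('D_(base_coord w') (conn g X) (base_coord z)) (fibre_coord w)
  + mxcomm ('D_(base_coord w) (conn g X) (base_coord z)) (fibre_coord w').

Lemma ddvert_sym z w w' X : V (base_coord z) -> ddvert z w w' X = ddvert z w' w X.
Proof.
move=> Vz.
have := smooth_mx_derive_comm Vo (base_coord w) (base_coord w') (conn_smooth gV X) Vz.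
rewrite /ddvert.
generalize ('D_(base_coord w) ('D_(base_coord w') (conn g X)) (base_coord z)).
generalize ('D_(base_coord w') ('D_(base_coord w) (conn g X)) (base_coord z)).
generalize ('D_(base_coord w) (conn g X) (base_coord z)).
generalize ('D_(base_coord w') (conn g X) (base_coord z)) => a b c _ ->.
exact: addrAC.
Qed.

Lemma is_derive_dvert z w w' X : V (base_coord z) ->
  is_derive z w (fun y => dvert y w' X) (ddvert z w w' X).
Proof.
move=> Vz; have cs := conn_smooth gV X.
have d1 := is_derive_base (smooth_mx_derive (base_coord w) cs Vz).
have d2 := is_derive_base (smooth_mx_derive (base_coord w)
  (smooth_mxD Vo (base_coord w') cs) Vz).
exact: is_derive_add (is_derive_mxcomm d2 (is_derive_fibre z w))
  (is_derive_mxcomm_cst (fibre_coord w') d1).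
Qed.

(** The derivative along [w] of the field [nabla_vert _ w' u]. *)
Definition dnabla_vert z w w' u : 'M[R]_n :=
  ddvert z w w' (base_coord u)
  + (mxcomm ('D_(base_coord w) (conn g (base_coord w')) (base_coord z))
       (vertical_part g z u)
     + mxcomm (conn g (base_coord w') (base_coord z)) (dvert z w (base_coord u))).

(** The vertical part of the derivative of [sasaki_conn] is not the derivative of
    its vertical part: the splitting moves with the point, which is the term
    [dvert]. *)
Lemma is_derive_sasaki_conn z w w' u : V (base_coord z) ->
  exists2 D, is_derive z w (fun y => sasaki_conn y w' u) D &
  base_coord D = base_coord u
    *m ('D_(base_coord w) (conn gam (base_coord w')) (base_coord z))^T /\
  vertical_part g z D = dnabla_vert z w w' u - dvert z w (nabla_hor z w' u).
Proof.
move=> Vz; set X := base_coord u; set Y := base_coord w'.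
have dgam := is_derive_base (smooth_mx_derive (base_coord w) (conn_smooth gamV Y) Vz).
have dconn := is_derive_base (smooth_mx_derive (base_coord w) (conn_smooth gV Y) Vz).
have da : is_derive z w (fun y => nabla_hor y w' u)
    (X *m ('D_(base_coord w) (conn gam Y) (base_coord z))^T).
  have D := is_derive_mulmx (is_derive_const X z w) (is_derive_trmx dgam).
  by apply: (@is_derive_eq _ _ _ _ _ _ _ _ D); rewrite mul0mx add0r.
have dK := is_derive_add (is_derive_dvert w w' X Vz)
  (is_derive_mxcomm dconn (is_derive_vertical_part w u Vz)).
rewrite -/(dnabla_vert z w w' u) in dK.
set da' := X *m _ in da; set dK' := dnabla_vert _ _ _ _ in dK *.
have dH := is_derive_mxcomm (is_derive_fibre z w) (is_derive_conn Vz da).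
have dB := is_derive_add (is_derive_mxvec dH) (is_derive_mxvec dK).
have D := is_derive_row_mx da dB.
set D' := row_mx _ _ in D; exists D'.
  move: D; congr (is_derive _ _ _ _); apply/funext => y.
  by rewrite /sasaki_conn /hlift /vlift hlift_fibreE add_row_mx addr0.
split; first by rewrite /base_coord row_mxKl.
rewrite vertical_partE /base_coord /fibre_coord row_mxKl row_mxKr.
rewrite linearD/= !mxvecK -/(base_coord z) -/(fibre_coord z) /dvert.
clear D D' dB dH dK da.
move: dK' da' (nabla_hor z w' u) => K a X'.
move: ('D_(base_coord w) _ _) => P.
move: (conn g a _) (conn g X' _) (fibre_coord z) (fibre_coord w) => c d t b.
rewrite /mxcomm; mx_abel.
Qed.

(** In the next two lemmas [D1] and [D2] stand for the derivatives of
    [sasaki_conn _ w' u] along [w] and of [sasaki_conn _ w u] along [w'], so that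
    the left-hand sides are the two parts of the curvature R(w, w') u. *)
Lemma sasaki_conn_comm_hor z w w' u D1 D2 :
  let Y := base_coord w in let Y' := base_coord w' in
  base_coord D1 = base_coord u *m ('D_Y (conn gam Y') (base_coord z))^T ->
  base_coord D2 = base_coord u *m ('D_Y' (conn gam Y) (base_coord z))^T ->
  base_coord (D1 - D2 + (sasaki_conn z w (sasaki_conn z w' u)
                         - sasaki_conn z w' (sasaki_conn z w u)))
  = base_coord u *m (curv gam (base_coord z) Y Y')^T.
Proof.
move=> Y Y' b1 b2.
have bE (a b c d : W) : base_coord (a - b + (c - d))
    = base_coord a - base_coord b + (base_coord c - base_coord d) :> 'rV[R]_n.
  by apply/rowP => k; rewrite !mxE.
have E a b : base_coord (sasaki_conn z a (sasaki_conn z b u))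
   = base_coord u *m (conn gam (base_coord b) (base_coord z))^T
     *m (conn gam (base_coord a) (base_coord z))^T.
  by rewrite base_sasaki_conn /nabla_hor base_sasaki_conn.
have := E w w'; have := E w' w; rewrite -/Y -/Y'.
generalize (sasaki_conn z w (sasaki_conn z w' u)) => c.
generalize (sasaki_conn z w' (sasaki_conn z w u)) => c' Ec' Ec.
rewrite bE b1 b2 Ec Ec' /curv {b1 b2 c c' Ec Ec' E}.
generalize ('D_Y (conn gam Y') (base_coord z)) => a.
generalize ('D_Y' (conn gam Y) (base_coord z)) => b.
move: (conn gam Y (base_coord z)) (conn gam Y' (base_coord z)) => c d.
rewrite !(trmxB, trmxD, trmx_mul); mx_abel.
Qed.

(** The motion of the splitting cancels between the derivative and the composite
    of the connections, the second derivatives commute, and the curvature of the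
    fibres is left. *)
Lemma sasaki_conn_comm_vert z w w' u D1 D2 : V (base_coord z) ->
  vertical_part g z D1 = dnabla_vert z w w' u - dvert z w (nabla_hor z w' u) ->
  vertical_part g z D2 = dnabla_vert z w' w u - dvert z w' (nabla_hor z w u) ->
  vertical_part g z (D1 - D2 + (sasaki_conn z w (sasaki_conn z w' u)
                         - sasaki_conn z w' (sasaki_conn z w u)))
  = mxcomm (curv g (base_coord z) (base_coord w) (base_coord w'))
           (vertical_part g z u).
Proof.
move=> Vz v1 v2.
pose Lv := GRing.isLinear.Build _ _ _ _ _ (vertical_part_linear g z).
pose fv : {linear W -> 'M[R]_n} := HB.pack (vertical_part g z) Lv.
have vE a b c d : vertical_part g z (a - b + (c - d))
    = vertical_part g z a - vertical_part g z b
      + (vertical_part g z c - vertical_part g z d).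
  by have := linearD fv (a - b) (c - d); rewrite !(linearB fv).
have E a b : vertical_part g z (sasaki_conn z a (sasaki_conn z b u))
   = dvert z a (nabla_hor z b u)
     + mxcomm (conn g (base_coord a) (base_coord z)) (nabla_vert z b u).
  rewrite vertical_sasaki_conn {1}/nabla_vert.
  by rewrite base_sasaki_conn vertical_sasaki_conn.
have := E w w'; have := E w' w.
generalize (sasaki_conn z w (sasaki_conn z w' u)) => c.
generalize (sasaki_conn z w' (sasaki_conn z w u)) => c' Ec' Ec.
rewrite vE v1 v2 Ec Ec' {E Ec Ec' c c' vE fv Lv v1 v2}.
rewrite /dnabla_vert (ddvert_sym w w' _ Vz) /nabla_vert /curv.
move: (ddvert _ _ _ _) (dvert z w (base_coord u)) (dvert z w' (base_coord u)).
move: (dvert z w _) (dvert z w' _) (vertical_part g z u) => p p' v q r r'.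
generalize ('D_(base_coord w) (conn g (base_coord w')) (base_coord z)) => a.
generalize ('D_(base_coord w') (conn g (base_coord w)) (base_coord z)) => b.
move: (conn g (base_coord w) (base_coord z)) (conn g (base_coord w') (base_coord z))
  => c d.
rewrite /mxcomm; mx_abel.
Qed.

(** By [sasaki_christoffel], [sasaki_conn] is the Levi-Civita connection at these
    points. *)
Let good z := V (base_coord z) /\
  forall X Y, mxcomm (curv g (base_coord z) X Y) (fibre_coord z) = 0.

(** The formula of the curvature of [sasaki_conn].  To differentiate the
    Christoffel symbols along two coordinate lines, they need only be known on
    these lines. *)
Lemma sasaki_riemann z m l j r :
  (\forall s \near (0 : R), good (s *: delta_mx 0 m + z)) ->
  (\forall s \near (0 : R), good (s *: delta_mx 0 l + z)) ->
  riemann (sasaki_comp g F) z m l j r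
  = (hlift g z (base_coord (delta_mx 0 j) *m
       (curv gam (base_coord z) (base_coord (delta_mx 0 m))
          (base_coord (delta_mx 0 l)))^T)
     + vlift (mxcomm (curv g (base_coord z) (base_coord (delta_mx 0 m))
          (base_coord (delta_mx 0 l))) (vertical_part g z (delta_mx 0 j)))) 0 r.
Proof.
pose e k : W := delta_mx 0 k; rewrite -!/(e _) => Gm Gl.
have [Vz Hz] : good z by have := nbhs_singleton Gm; rewrite scale0r add0r.
have ch a b c := sasaki_christoffel a b c Vz Hz.
have P k a b D : (\forall s \near (0 : R), good (s *: e k + z)) ->
    is_derive z (e k) (fun y => sasaki_conn y (e a) (e b)) D ->
    partial k (fun y => christoffel (sasaki_comp g F) y a b r) z = D 0 r.
  move=> Gk /is_derive_mxP/(_ 0 r) d.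
  have [] : is_derive z (e k) (fun y => christoffel (sasaki_comp g F) y a b r) (D 0 r).
    apply: is_derive_along_line d; apply: filterS Gk => s [Vs Hs].
    by rewrite sasaki_christoffel.
  by [].
have Q a u : \sum_s christoffel (sasaki_comp g F) z a s r * u 0 s
    = sasaki_conn z (e a) u 0 r.
  pose Lc := GRing.isLinear.Build _ _ _ _ _ (sasaki_conn_linear (e a) Vz).
  pose fc : {linear W -> W} := HB.pack (sasaki_conn z (e a)) Lc.
  rewrite {2}(row_sum_delta u) -[sasaki_conn _ _]/(fc : W -> W) linear_sum.
  rewrite summxE; apply: eq_bigr => s _.
  by rewrite linearZ mxE mulrC ch.
have [D1 d1 [b1 v1]] := is_derive_sasaki_conn (e m) (e l) (e j) Vz.
have [D2 d2 [b2 v2]] := is_derive_sasaki_conn (e l) (e m) (e j) Vz.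
rewrite /riemann (P _ _ _ _ Gm d1) (P _ _ _ _ Gl d2) sumrB.
have QQ a b c : \sum_(s < n + n * n) christoffel (sasaki_comp g F) z a s r *
     christoffel (sasaki_comp g F) z b c s
   = sasaki_conn z (e a) (sasaki_conn z (e b) (e c)) 0 r.
  by rewrite -Q; apply: eq_bigr => s _; rewrite (ch b c).
rewrite !QQ; set T := _ + vlift _.
pose U := D1 - D2 + (sasaki_conn z (e m) (sasaki_conn z (e l) (e j))
   - sasaki_conn z (e l) (sasaki_conn z (e m) (e j))).
suff -> : T = U.
  rewrite /U; move: (sasaki_conn z (e m) _) (sasaki_conn z (e l) _) => a b.
  by clear; rewrite !mxE.
apply: etrans (esym (lift_decomposition g z U)).
rewrite /horizontal_part -/(base_coord U).
by rewrite /T (sasaki_conn_comm_hor b1 b2) (sasaki_conn_comm_vert Vz v1 v2).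
Qed.
End SasakiCurvature.

(** * Flatness in a coordinate domain *)

Lemma mxcomm_delta_scalar (R : realType) n (A : 'M[R]_n) :
  (forall a b, mxcomm A (delta_mx a b) = 0) ->
  forall i j k, A i j = (i == j)%:R * A k k.
Proof.
move=> H i j k.
have E a b p q : A p a * (q == b)%:R = (p == a)%:R * A b q.
  have := H a b => /matrixP/(_ p q); rewrite !mxE => /eqP; rewrite subr_eq0 => /eqP.
  rewrite (bigD1 a)//= [X in _ + X]big1 ?addr0 => [|s /negbTE sa]; last first.
    by rewrite mxE sa mulr0.
  rewrite [in RHS](bigD1 b)//= [X in _ = _ + X]big1 ?addr0 => [|s /negbTE sb]; last first.
    by rewrite mxE sb andbF mul0r.
  by rewrite !mxE !eqxx andbT /=.
by have := E j k i k; rewrite eqxx mulr1.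
Qed.

Lemma lift_eq0 (R : realType) n (g : 'rV[R]_n -> 'M[R]_n) z X A :
  (hlift g z X + vlift A == 0) = (X == 0) && (A == 0).
Proof.
rewrite /hlift /vlift add_row_mx addr0 -(row_mx0 _ 1 n (n * n)).
apply/eqP/andP => [/eq_row_mx[X0]|].
  rewrite X0 hlift_fibreE -linearD => /eqP; rewrite mxvec_eq0.
  by rewrite conn0 mxcomm0r add0r eqxx.
move=> [/eqP-> /eqP->]; rewrite hlift_fibreE.
by rewrite conn0 mxcomm0r !linear0 addr0.
Qed.

Section LocalFlatness.
Variables (R : realType) (n : nat) (V : set 'rV[R]_n).
Variables (g : 'rV[R]_n -> 'M[R]_n) (F : 'rV[R]_n -> R).
Hypothesis gV : local_metric V g.
Hypothesis Fs : smooth V F.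
Hypothesis F0 : forall x, V x -> F x != 0.
Let Vo := lm_open gV.
Let gam y := F y *: g y.
Let gamV : local_metric V gam. Proof. exact: local_metric_scale. Qed.

Lemma near_base z w : V (base_coord z) ->
  \forall s \near (0 : R), V (base_coord (s *: w + z)).
Proof.
move=> Vz; have := near_line (base_coord w) (near_open Vo Vz (fun y Vy => Vy)).
by apply: filterS => s; rewrite /base_coord linearP.
Qed.

Lemma sasaki_flat z : V (base_coord z) ->
  (forall x, V x -> forall m l j r, riemann g x m l j r = 0) ->
  (forall x, V x -> forall m l j r, riemann gam x m l j r = 0) ->
  forall m l j r, riemann (sasaki_comp g F) z m l j r = 0.
Proof.
move=> Vz Rg Rgam m l j r.
have mxcomm0l (B : 'M[R]_n) : mxcomm 0 B = 0.
  by rewrite /mxcomm mul0mx mulmx0 subr0.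
have good w : \forall s \near (0 : R), V (base_coord (s *: w + z)) /\
    forall X Y, mxcomm (curv g (base_coord (s *: w + z)) X Y)
                       (fibre_coord (s *: w + z)) = 0.
  apply: filterS (near_base w Vz) => s Vs; split=> // X Y.
  by rewrite (curv_eq0 gV Vs (Rg _ Vs)) mxcomm0l.
rewrite (sasaki_riemann gV Fs F0) //.
rewrite (curv_eq0 gV Vz (Rg _ Vz)) (curv_eq0 gamV Vz (Rgam _ Vz)).
rewrite mxcomm0l trmx0 mulmx0.
have /eqP -> : hlift g z 0 + vlift 0 == 0 by rewrite lift_eq0 !eqxx.
by rewrite mxE.
Qed.

(** On the zero section [sasaki_conn] is torsion-free whatever the curvature of
    [g].  The horizontal basis vectors give the curvature of [gam]; the vertical
    ones show that the curvature of [g] commutes with every matrix, so that it is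
    scalar, and skewness with respect to [g] leaves only zero. *)
Lemma flat_of_sasaki_flat x : V x ->
  (forall m l j r, riemann (sasaki_comp g F) (row_mx x 0) m l j r = 0) ->
  forall m l j r, riemann g x m l j r = 0 /\ riemann gam x m l j r = 0.
Proof.
move=> Vx R0 m l j r; set z := row_mx x 0 in R0.
have bz : base_coord z = x by rewrite /base_coord row_mxKl.
have fz : fibre_coord z = 0 by rewrite /fibre_coord row_mxKr linear0.
clearbody z; have Vz : V (base_coord z) by rewrite bz.
pose e k : 'rV[R]_(n + n * n) := delta_mx 0 k.
have be i : base_coord (e (lshift _ i)) = delta_mx 0 i.
  by apply/rowP => k; rewrite !mxE eq_lshift.
have fe i : fibre_coord (e (lshift _ i)) = 0.
  by apply/matrixP => a b; rewrite !mxE eq_rlshift andbF.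
have good i : \forall s \near (0 : R), V (base_coord (s *: e (lshift _ i) + z)) /\
    forall X Y, mxcomm (curv g (base_coord (s *: e (lshift _ i) + z)) X Y)
                       (fibre_coord (s *: e (lshift _ i) + z)) = 0.
  apply: filterS (near_base (e (lshift _ i)) Vz) => s Vs; split=> // X Y.
  have -> : fibre_coord (s *: e (lshift _ i) + z) = 0.
    apply/matrixP => p q; have := fe i => /matrixP/(_ p q).
    have := fz => /matrixP/(_ p q).
    by rewrite !mxE => -> ->; rewrite mulr0 addr0.
  exact: mxcomm0r.
have E k : base_coord (e k) *m (curv gam x (delta_mx 0 m) (delta_mx 0 l))^T = 0
    /\ mxcomm (curv g x (delta_mx 0 m) (delta_mx 0 l)) (vertical_part g z (e k)) = 0.
  suff /eqP : hlift g z (base_coord (e k) *m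
       (curv gam x (delta_mx 0 m) (delta_mx 0 l))^T)
     + vlift (mxcomm (curv g x (delta_mx 0 m) (delta_mx 0 l))
         (vertical_part g z (e k))) = 0.
    by rewrite lift_eq0 => /andP[/eqP -> /eqP ->].
  apply/rowP => i; rewrite [RHS]mxE; apply: etrans (R0 (lshift _ m) (lshift _ l) k i).
  by rewrite (sasaki_riemann gV Fs F0 k i (good m) (good l)) !be bz.
split; last first.
  have [+ _] := E (lshift _ j); rewrite be -rowE => /rowP/(_ r).
  by rewrite [LHS]mxE [LHS]mxE [RHS]mxE (curv_delta gamV).
set A := curv g x _ _ in E.
have /mxcomm_delta_scalar Asc a b : mxcomm A (delta_mx a b) = 0.
  have [_] := E (rshift n (mxvec_index a b)).
  rewrite vertical_partE fz mxcomm0r addr0 => <-; congr mxcomm.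
  apply/matrixP => p q; rewrite !mxE eqxx eq_rshift andTb.
  by have := mxvec_delta R a b => /rowP/(_ (mxvec_index p q)); rewrite mxvecE !mxE eqxx.
rewrite -(curv_delta gV)// -/A (Asc r j j).
suff -> : A j j = 0 by rewrite mulr0.
have A1 : A = (A j j)%:M.
  by apply/matrixP => p q; rewrite (Asc p q j) [RHS]mxE mulr_natl.
have := curv_skew gV (delta_mx 0 m) (delta_mx 0 l) Vx; rewrite -/A A1.
rewrite tr_scalar_mx mul_scalar_mx mul_mx_scalar -mulr2n -scaler_nat scalerA.
move=> /(congr1 (mulmx^~ (invmx (g x)))).
rewrite -scalemxAl mulmxV ?(lm_unit gV)// mul0mx => /matrixP/(_ j j).
by rewrite !mxE eqxx mulr1 => /eqP; rewrite mulf_eq0 pnatr_eq0 => /eqP.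
Qed.
End LocalFlatness.

(** * The theorem on a manifold *)

Section Charts.
Variables (R : realType) (n : nat) (M : smoothManifold R n).
Variables (g : riemannianMetric M) (f : M -> R).

Lemma chart_local_metric (a : chart_index M) :
  local_metric (chart a @` chart_dom a) (metric_comp g a).
Proof.
split=> [|k i j|_ [p pa <-]|_ [p pa <-]].
- exact: chart_image_open.
- by apply: smooth_on_smooth; [exact: chart_image_open | exact: metric_smooth].
- exact: (Defs.metric_sym g pa).
rewrite -row_free_unit; apply: inj_row_free => v vg; apply/eqP.
apply: contraT => /(metric_posdef g pa).
by rewrite vg mul0mx mxE ltxx.
Qed.

Lemma zero_tensor_transform (p : M) (a b : chart_index M) :
  (0 : 'M[R]_n) = transition_jacobian a b p *m 0 *m transition_jacobian b a p.
Proof. by rewrite mulmx0 mul0mx. Qed.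

Definition zero_tensor (p : M) : tensor11 p :=
  @Tensor11 R n M p (fun=> 0) (fun a _ => erefl)
    (fun a b _ _ => zero_tensor_transform p a b).
End Charts.

Theorem theorem7 (R : realType) (n : nat) (M : smoothManifold R n)
    (g : riemannianMetric M) (f : M -> R)
    (f_smooth : smooth_function f) (f_gt0 : forall p : M, 0 < f p) :
  locally_flat (sasaki_metric g f) <->
  locally_flat g /\
  (forall (a : chart_index M) (p : M), chart_dom a p ->
   forall m l j r : 'I_n,
   let F := fun x => f (chart_inv a x) in
   let A := fA (metric_comp g a) F in
   let x := chart a p in
   nabla12 (metric_comp g a) (fun y l j r => (2 * F y)^-1 * A y l j r) x m l j r
   - nabla12 (metric_comp g a) (fun y l j r => (2 * F y)^-1 * A y l j r) x l m j r
   + (4 * F x ^+ 2)^-1 * (\sum_(s < n) A x m s r * A x l j s)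
   - (4 * F x ^+ 2)^-1 * (\sum_(s < n) A x l s r * A x m j s) = 0).
Proof.
have gV a := chart_local_metric g a.
pose V (a : chart_index M) := chart a @` chart_dom a.
pose F a x := f (chart_inv a x).
have Fs a : smooth (V a) (F a).
  by apply: smooth_on_smooth; [exact: chart_image_open | exact: f_smooth].
have F0 a x : V a x -> F a x != 0 by move=> _; exact: lt0r_neq0 (f_gt0 _).
(* the displayed equation in the theorem is the last summand of [scale] *)
pose scale a p pa m l j r :=
  riemann_scale (gV a) (Fs a) (@F0 a) m l j r (imageP (chart a) (pa : chart_dom a p)).
split=> [flat|[gflat eq0]].
  have H a p : chart_dom a p -> forall m l j r,
      riemann (metric_comp g a) (chart a p) m l j r = 0 /\
      riemann (fun y => F a y *: metric_comp g a y) (chart a p) m l j r = 0.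
    move=> pa; apply: (flat_of_sasaki_flat (gV a) (Fs a) (@F0 a)).
      exact: imageP.
    (* the point of the zero section over p *)
    move=> m l j r; have := flat a (existT _ p (zero_tensor p)) pa m l j r.
    by rewrite /= linear0.
  split=> [a p pa m l j r|a p pa m l j r /=]; first by case: (H a p pa m l j r).
  have [Rg Rgam] := H a p pa m l j r.
  by move: Rgam; rewrite (scale a p pa) Rg add0r.
move=> a [p t] /= pa m l j r.
apply: (sasaki_flat (gV a) (Fs a) (@F0 a)).
- by rewrite /base_coord row_mxKl; exact: imageP.
- by move=> _ [q qa <-] *; exact: gflat.
- move=> _ [q qa <-] m' l' j' r'.
  by rewrite (scale a q qa) (gflat a q qa) add0r; exact: eq0.
Qed.
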